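(* Let $\Omega\subseteq\mathbb{C}$ be a simply connected infinite compact set with exterior Riemann map $\mathcal{R}_\Omega$ and $d_1=\mathcal{R}_\Omega'(\infty)>0$. Let $P_n(z)=\sum_{j=0}^n p_jz^j$ be a polynomial of degree $n\ge2$ such that $E=P_n^{-1}(\Omega)$ is connected, i.e., $\ell=1$. Then the set $L$ associated with $E$ by Walsh's theorem is $$L=\{w\in\mathbb{C}:|w-a_1|\le(d_1|p_n|)^{-1/n}\}$$ with $m_1=1$ and $a_1=-\frac{p_{n-1}}{np_n}$, and the Walsh map is $$\Phi:E^c\to L^c,\qquad\Phi(z)=a_1+\sqrt[n]{\frac{\mathcal{R}_\Omega(P_n(z))}{d_1p_n}},$$ with that branch of the $n$-th root such that $\Phi(z)=z+\mathcal{O}(1/z)$ at infinity.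
   Context: $\widehat{\mathbb{C}}=\mathbb{C}\cup\{\infty\}$, $K^c=\widehat{\mathbb{C}}\setminus K$, $\mathbb{D}$ is the open unit disk. A compact set $K\subseteq\mathbb{C}$ is called simply connected if $K$ and $K^c$ are both connected. $\operatorname{cap}(K)$ is the logarithmic capacity. The exterior Riemann map of $\Omega$ is the conformal map $\mathcal{R}_\Omega:\Omega^c\to\overline{\mathbb{D}}^c$ with $\mathcal{R}_\Omega(z)=d_1z+d_0+\sum_{k\ge1}d_{-k}z^{-k}$ near $\infty$ and $d_1=\mathcal{R}_\Omega'(\infty)=1/\operatorname{cap}(\Omega)>0$. $E=P_n^{-1}(\Omega)=\{z\in\mathbb{C}:P_n(z)\in\Omega\}$. Walsh's theorem (known): if $E_1,\ldots,E_\ell\subseteq\mathbb{C}$ are disjoint simply connected, infinite compact sets and $E=\bigcup_j E_j$, then there exist a unique compact set of the form $L=\{w\in\mathbb{C}:|U(w)|\le\operatorname{cap}(E)\}$, $|U(w)|=\prod_{j=1}^\ell|w-a_j|^{m_j}$, with distinct $a_1,\ldots,a_\ell\in\mathbb{C}$ (centers) and real $m_1,\ldots,m_\ell>0$ (exponents), $\sum_{j=1}^\ell m_j=1$, and a unique conformal (i.e. bijective holomorphic) map $\Phi:E^c\to L^c$ with $\Phi(z)=z+\mathcal{O}(1/z)$ at $\infty$ (the Walsh map). The $a_j$ and $m_j$ are uniquely determined. *)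

(* Defs.v *)
From HB Require Import structures.
From mathcomp Require Import all_boot all_order all_algebra.
From mathcomp Require Import complex.
From mathcomp Require Import all_classical all_reals all_analysis.

Set Implicit Arguments.
Unset Strict Implicit.
Unset Printing Implicit Defensive.

Import Order.TTheory GRing.Theory Num.Theory.
Import numFieldNormedType.Exports.

Local Open Scope classical_set_scope.
Local Open Scope ring_scope.

Notation normc := ComplexField.Normc.normc.

(* The library puts the topology of the field [R[i]] on its alias [R[i]^o]. *)

(* The Riemann sphere: [None] is the point at infinity. *)
Notation sphere R := (one_point_compactification R[i]^o).

Definition complS (R : realType) (K : set R[i]) : set (sphere R) :=
  ~` (Some @` K : set (sphere R)).

Definition simply_connected (R : realType) (K : set R[i]) : Prop :=
  connected (K : set R[i]^o) /\ connected (complS K).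

(* ** Logarithmic capacity: cap K = sup_mu exp (I mu), where
   I mu = \int\int log |z - w| dmu(w) dmu(z) and mu ranges over the Borel
   probability measures carried by K (so cap K = 0 for polar K).  *)
Definition borelC (R : realType) := g_sigma_algebraType (@open R[i]^o).

Definition energy (R : realType) (mu : probability (borelC R) R) : \bar R :=
  (\int[mu]_z \int[mu]_w lne (normc ((z : R[i]) - (w : R[i])))%:E)%E.

(* For compact K the supremum is finite, and [fine] maps the supremum over the
   empty family (K empty) to 0. *)
Definition cap (R : realType) (K : set R[i]) : R :=
  fine (ereal_sup
    [set expeR (energy mu) | mu in
      [set mu : probability (borelC R) R | mu (K : set (borelC R)) = 1%E]]).

(* ** Holomorphic and conformal maps between subsets of the sphere. *)

(* The chart of the sphere centred at the finite point or at infinity,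
   according to [q]: z |-> z, resp. z |-> 1/z with infinity |-> 0. The values
   chosen outside the domain of each chart (infinity, resp. 0) are junk. *)
Definition chart (R : realType) (q p : sphere R) : R[i] :=
  match q, p with
  | Some _, Some z => z
  | Some _, None => 0
  | None, Some z => z^-1
  | None, None => 0
  end.

Definition chartV (R : realType) (q : sphere R) (u : R[i]) : sphere R :=
  match q with
  | Some _ => Some u
  | None => if u == 0 then None else Some u^-1
  end.

(* Complex differentiability at [p], read in the charts at [p] and [f p].
   Continuity at [p] keeps the junk values of the charts out of the picture. *)
Definition differentiable_at (R : realType) (f : sphere R -> sphere R)
    (p : sphere R) : Prop :=
  {for p, continuous f} /\
  derivable ((fun u => chart (f p) (f (chartV p u))) : R[i]^o -> R[i]^o)
    (chart p p) 1.

Definition conformal (R : realType) (A B : set (sphere R))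
    (f : sphere R -> sphere R) : Prop :=
  (forall p, A p -> differentiable_at f p) /\ set_bij A B f.

Definition holomorphic_on (R : realType) (A : set R[i]) (s : R[i] -> R[i]) :
    Prop :=
  forall z, A z -> derivable (s : R[i]^o -> R[i]^o) z 1.

(* [f z = z + O(1/z)] as [z] tends to infinity. *)
Definition hydrodynamic (R : realType) (f : sphere R -> sphere R) : Prop :=
  exists M c : R, forall z : R[i], M < normc z ->
    exists2 w, f (Some z) = Some w & normc (w - z) <= c / normc z.

(* The domain of the map is the complement of [K]; [d k] is the coefficient
   of z^(-k), for k = 0, 1, 2, etc. That d1 = 1 / cap K is a consequence. *)
Definition exterior_riemann_map (R : realType) (K : set R[i])
    (f : sphere R -> sphere R) (d1 : R) : Prop :=
  [/\ conformal (complS K) (complS [set w : R[i] | normc w <= 1]) f,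
      0 < d1 &
      exists (M : R) (d : nat -> R[i]), forall z : R[i], M < normc z ->
        exists2 w, f (Some z) = Some w &
          series (fun k => (d k * z ^- k : R[i]^o)) @ \oo
            --> (w - real_complex R d1 * z : R[i]^o)].

(* The data (a, m, L, Phi) that Walsh's theorem associates with the compact set
   [E] having [l] components: centers, exponents, the complement [L] of the
   lemniscatic domain, and the Walsh map. *)
Definition walsh_data (R : realType) (l : nat) (E : set R[i])
    (a : 'I_l -> R[i]) (m : 'I_l -> R) (L : set R[i])
    (Phi : sphere R -> sphere R) : Prop :=
  [/\ injective a,
      (forall j, 0 < m j) /\ \sum_(j < l) m j = 1,
      L = [set w | \prod_(j < l) normc (w - a j) `^ m j <= cap E],
      conformal (complS E) (complS L) Phi &
      hydrodynamic Phi].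

(* Acts on finite points and fixes infinity. *)
Definition extendS (R : realType) (g : R[i] -> R[i]) : sphere R -> sphere R :=
  omap g.

(* [s] is a holomorphic branch on the finite part of the complement of [E] of
   the n-th root of f(P(z)) / c. *)
Definition root_branch (R : realType) (n : nat) (E : set R[i])
    (f : sphere R -> sphere R) (P : {poly R[i]}) (c : R[i])
    (s : R[i] -> R[i]) : Prop :=
  holomorphic_on (~` E) s /\
  forall z, ~ E z ->
    exists2 x, f (Some P.[z]) = Some x & s z ^+ n = x / c.

(* Main.v *)
(* Let [psi = Phi - a1] and [rho = Rmap o P], so that [|psi| > cap E] and
   [|rho| > 1] off [E], while these moduli tend to [cap E] and [1] at the boundary
   of [E]. The quotient [rho / psi ^ n] tends to [c = d1 * p_n] at infinity, so by
   the maximum principle for it and its inverse its modulus is the constant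
   [(cap E) ^ (- n)]; hence the quotient is the constant [c]. This yields
   [psi ^ n = rho / c] together with the value of [cap E], without computing any
   energy; comparing the coefficients of [z ^ (n - 1)] at infinity gives [a1]. Two
   branches of the root differ by a factor of modulus one that tends to [1] at
   infinity, hence they agree.

   The maximum principle comes from Goursat's theorem on rectangles. Properness of
   [psi] and [rho] rests on the continuity of the inverse of an injective
   holomorphic map, again a consequence of the maximum principle. *)
Require Import Defs.
From HB Require Import structures.
From mathcomp Require Import all_boot all_order all_algebra.
From mathcomp Require Import complex.
From mathcomp Require Import all_classical all_reals all_analysis.
From mathcomp Require Import ring lra.

Set Implicit Arguments.
Unset Strict Implicit.
Unset Printing Implicit Defensive.

Import Order.TTheory GRing.Theory Num.Theory.
Import numFieldNormedType.Exports.

Local Open Scope classical_set_scope.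
Local Open Scope ring_scope.
Import ComplexField.Normc.

Local Notation Re := (@complex.Re _).
Local Notation Im := (@complex.Im _).

(** * The plane *)

(** Conformality only provides bijections between open sets: no boundary values of [psi] or [rho]
    are available. The maximum principle is therefore stated with compact sets instead of boundary
    limits: for every level [M' > M], the part of the domain where the modulus exceeds [M'] has to
    lie in a compact subset of the domain. Properness of the maps supplies these compact sets. The
    quotient [rho / psi ^ n] has a nonzero limit at infinity, so the region where its modulus is
    large need not be bounded; this is why auxiliary functions that vanish at infinity take its
    place.

    The capacity enters as an unknown radius [r >= 0]; that [r > 0] follows from the first of the
    two inequalities between [|psi| ^ n] and [r ^ n * |rho|].

    The Cauchy estimate carries a crude constant 4. Any constant independent of the function would
    do, since applying the estimate to high powers turns the constant into 1. *)

Lemma cReD (R : realType) (z w : R[i]) : Re (z + w) = Re z + Re w.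
Proof. by case: z; case: w. Qed.

Lemma cImD (R : realType) (z w : R[i]) : Im (z + w) = Im z + Im w.
Proof. by case: z; case: w. Qed.

Lemma cReN (R : realType) (z : R[i]) : Re (- z) = - Re z.
Proof. by case: z. Qed.

Lemma cImN (R : realType) (z : R[i]) : Im (- z) = - Im z.
Proof. by case: z. Qed.

Lemma cReM (R : realType) (z w : R[i]) : Re (z * w) = Re z * Re w - Im z * Im w.
Proof. by case: z; case: w. Qed.

Lemma cImM (R : realType) (z w : R[i]) : Im (z * w) = Re z * Im w + Im z * Re w.
Proof. by case: z; case: w. Qed.

Lemma norm_normc (R : realType) (z : R[i]) : `|z| = real_complex R (normc z).
Proof. by []. Qed.

Lemma normc_ge0 (R : realType) (z : R[i]) : 0 <= normc z.
Proof. by rewrite -lecR -norm_normc normr_ge0. Qed.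

Lemma normc_eq0 (R : realType) (z : R[i]) : (normc z == 0) = (z == 0).
Proof.
apply/idP/idP => [/eqP n0|/eqP ->]; last by rewrite normc0.
by apply/eqP; exact: eq0_normc.
Qed.

Lemma normc_gt0 (R : realType) (z : R[i]) : (0 < normc z) = (z != 0).
Proof. by rewrite lt_def normc_eq0 normc_ge0 andbT. Qed.

Lemma normcX (R : realType) (z : R[i]) n : normc (z ^+ n) = normc z ^+ n.
Proof. by elim: n => [|n IH]; rewrite ?expr0 ?normc1 // !exprS normcM IH. Qed.

Lemma normc_distC (R : realType) (z w : R[i]) : normc (z - w) = normc (w - z).
Proof. by rewrite -normcN opprB. Qed.

Lemma normc_real (R : realType) (x : R) : normc (real_complex R x) = `|x|.
Proof. by rewrite /= expr0n /= addr0 sqrtr_sqr. Qed.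

Lemma ler_normcB (R : realType) (z w : R[i]) : normc z - normc w <= normc (z - w).
Proof. by rewrite lerBlDr -{1}(subrK w z) le_normcD. Qed.

Lemma le_Re_normc (R : realType) (z : R[i]) : `|Re z| <= normc z.
Proof. by rewrite -lecR; exact: normc_ge_Re. Qed.

Lemma le_Im_normc (R : realType) (z : R[i]) : `|Im z| <= normc z.
Proof.
by case: z => a b /=; rewrite -sqrtr_sqr ler_wsqrtr // lerDr sqr_ge0.
Qed.

Lemma normc_le_ReIm (R : realType) (z : R[i]) : normc z <= `|Re z| + `|Im z|.
Proof.
case: z => a b /=.
rewrite -[leRHS]ger0_norm ?addr_ge0// -sqrtr_sqr ler_wsqrtr //.
rewrite sqrrD !real_normK ?num_real// -addrA lerD2l lerDr.
by rewrite mulrn_wge0 // mulr_ge0.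
Qed.

(** Balls of [R[i]^o] have radii in [R[i]], whose order is partial. A positive element of [R[i]] is
    a positive real, so radii can be taken in [R]. *)
Lemma nbhs_normcP (R : realType) (z : R[i]^o) (A : set R[i]^o) :
  nbhs z A <->
  exists2 e : R, 0 < e & forall w : R[i], normc (w - z) < e -> A w.
Proof.
split.
  move=> /nbhs_ballP[e /= e0 eA]; exists (Re e).
    by move: e0; rewrite ltcE /= => /andP[].
  move=> w we; apply: eA; rewrite /ball /=.
  rewrite distrC norm_normc ltcE /=.
  by move: e0; rewrite ltcE /= => /andP[/eqP -> _]; rewrite eqxx.
move=> [e e0 eA]; apply/nbhs_ballP; exists (real_complex R e).
  by rewrite /= ltcR.
by move=> w; rewrite /ball /= distrC norm_normc ltcR; exact: eA.
Qed.

Lemma continuous_normcP (R : realType) (f : R[i]^o -> R[i]^o) (z : R[i]^o) :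
  {for z, continuous f} <->
  forall e : R, 0 < e -> exists2 d : R, 0 < d &
    forall w : R[i], normc (w - z) < d -> normc (f w - f z) < e.
Proof.
split=> [cf e e0|cf A /nbhs_normcP[e e0 eA]].
  have /cf /nbhs_normcP[d d0 dA] : nbhs (f z) [set w : R[i]^o | normc (w - f z) < e].
    by apply/nbhs_normcP; exists e.
  by exists d.
have [d d0 dA] := cf e e0.
by apply/nbhs_normcP; exists d => // w /dA /eA.
Qed.

Lemma open_normcP (R : realType) (A : set R[i]^o) :
  open A <-> forall z : R[i], A z -> exists2 e : R, 0 < e &
    forall w : R[i], normc (w - z) < e -> A w.
Proof.
rewrite openE; split => oA z /oA /nbhs_normcP //.
Qed.

Lemma Re_continuous (R : realType) : continuous (@complex.Re R : R[i]^o -> R).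
Proof.
move=> z A /nbhs_ballP[e e0 eA]; apply/nbhs_normcP; exists e => // w we.
apply: eA; rewrite /ball /= distrC -cReN -cReD.
exact: le_lt_trans (le_Re_normc _) we.
Qed.

Lemma Im_continuous (R : realType) : continuous (@complex.Im R : R[i]^o -> R).
Proof.
move=> z A /nbhs_ballP[e e0 eA]; apply/nbhs_normcP; exists e => // w we.
apply: eA; rewrite /ball /= distrC -cImN -cImD.
exact: le_lt_trans (le_Im_normc _) we.
Qed.

Lemma normc_continuous (R : realType) : continuous (@normc R : R[i]^o -> R).
Proof.
move=> z A /nbhs_ballP[e e0 eA]; apply/nbhs_normcP; exists e => // w we.
apply: eA; rewrite /ball /=; apply: le_lt_trans we.
rewrite ler_norml; apply/andP; split; last by rewrite normc_distC ler_normcB.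
by rewrite lerNl opprB ler_normcB.
Qed.

Lemma mkcomplex_continuous (R : realType) :
  continuous (fun p : R * R => (p.1 +i* p.2)%C : R[i]^o).
Proof.
move=> [x y] A /nbhs_normcP[e e0 eA].
have e20 : 0 < e / 2 by rewrite divr_gt0.
exists (ball x (e / 2), ball y (e / 2)); first by split; exact: nbhsx_ballx.
move=> [x' y'] [/= bx by_]; apply: eA.
apply: le_lt_trans (normc_le_ReIm _) _; rewrite /= (splitr e).
by rewrite ltrD // distrC.
Qed.

(** Carried over from a product of two real segments by the continuous map [(x, y) |-> x + iy]. *)
Lemma compact_rect (R : realType) (a b c d : R) :
  compact ([set z : R[i] | a <= Re z <= b /\ c <= Im z <= d] : set R[i]^o).
Proof.
have -> : [set z : R[i] | a <= Re z <= b /\ c <= Im z <= d] =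
    (fun p : R * R => (p.1 +i* p.2)%C : R[i]^o) @` (`[a, b] `*` `[c, d]).
  apply/seteqP; split => [[x y] /= [xab ycd]|z /= [[x y] /= [xab ycd] <-]].
    by exists (x, y) => //=; rewrite !in_itv.
  by move: xab ycd; rewrite !in_itv.
apply: continuous_compact; last first.
  by apply: compact_setX; exact: segment_compact.
by apply: continuous_subspaceT; exact: mkcomplex_continuous.
Qed.

Lemma normc_hausdorff (R : realType) : hausdorff_space R[i]^o.
Proof. exact: norm_hausdorff. Qed.

Lemma closed_bounded_compact (R : realType) (A : set R[i]^o) (M : R) :
  closed A -> (forall z : R[i], A z -> normc z <= M) -> compact A.
Proof.
move=> cA bA; apply: subclosed_compact cA (@compact_rect R (- M) M (- M) M) _.
move=> z /bA zM /=; rewrite -!ler_norml; split.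
  exact: le_trans (le_Re_normc _) zM.
exact: le_trans (le_Im_normc _) zM.
Qed.

Lemma compact_normc_bounded (R : realType) (A : set R[i]^o) :
  compact A -> exists2 M : R, 0 < M & forall z : R[i], A z -> normc z <= M.
Proof.
move=> cA; have [->|A0] := eqVneq A set0; first by exists 1.
have /set0P A0' := A0.
have [|c _ cmax] := @compact_EVT_max R[i]^o R (@normc R) A A0' cA.
  by apply: continuous_subspaceT; exact: normc_continuous.
exists (normc c + 1); first by rewrite ltr_wpDl ?normc_ge0.
by move=> z Az; rewrite (le_trans (cmax _ _)) ?inE // lerDl.
Qed.

(** Multiplying the difference quotient by [h] removes the exclusion of [h = 0]. In the converse
    direction [e / 2] turns the large inequality into the strict one that neighbourhoods ask for. *)
Lemma derivable_normcP (R : realType) (f : R[i]^o -> R[i]^o) (z : R[i]^o) :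
  derivable f z 1 <->
  exists l : R[i], forall e : R, 0 < e -> exists2 d : R, 0 < d &
    forall h : R[i], normc h < d ->
      normc (f (z + h) - f z - l * h) <= e * normc h.
Proof.
split.
  move=> /cvg_ex[l fl]; exists l => e e0.
  have : nbhs (l : R[i]^o) [set w : R[i]^o | normc (w - l) < e].
    by apply/nbhs_normcP; exists e.
  move=> /fl /nbhs_normcP[d d0 dA].
  exists d => // h hd; have [->|h0] := eqVneq h 0.
    by rewrite mulr0 normc0 mulr0 addr0 subr0 subrr normc0.
  have := dA h; rewrite subr0 => /(_ hd h0) /=.
  rewrite [h *: 1](mulr1 h) (addrC h) => /ltW fh.
  have -> : f (z + h) - f z - l * h = h * (h^-1 * (f (z + h) - f z) - l).
    by field.
  by rewrite normcM mulrC ler_wpM2r ?normc_ge0.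
move=> [l fl]; apply/cvg_ex; exists l => A /nbhs_normcP[e e0 eA].
have [d d0 dA] := fl (e / 2) (divr_gt0 e0 (ltr0n _ 2)).
apply/nbhs_normcP; exists d => // h; rewrite subr0 => hd h0; apply: eA.
have := dA h hd.
have -> : f (z + h) - f z - l * h = h * (h^-1 * (f (z + h) - f z) - l).
  by field.
rewrite normcM mulrC ler_pM2r ?normc_gt0 // => le2.
rewrite /= [h *: 1](mulr1 h) (addrC h) (le_lt_trans le2) //.
by rewrite ltr_pdivrMr // ltr_pMr // ltr1n.
Qed.

Lemma derivable_continuous_at (R : realType) (f : R[i]^o -> R[i]^o)
  (z : R[i]^o) : derivable f z 1 -> {for z, continuous f}.
Proof. by move=> /derivable1_diffP /differentiable_continuous. Qed.

(** * Goursat's theorem *)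

(** The subdivision argument of Goursat, for an arbitrary additive function [J] of rectangles.
    Halving both sides divides the square of the half-perimeter by 4, so one of the four quarters
    keeps [|J|] above [e] times that square. The nested quarters shrink to a point, where the local
    bound contradicts this. *)
Lemma bisection_zero (R : realType) (J : R -> R -> R -> R -> R[i])
    (a0 b0 c0 d0 : R) : a0 <= b0 -> c0 <= d0 ->
  (forall a e b c d, a0 <= a -> a <= e -> e <= b -> b <= b0 ->
    c0 <= c -> c <= d -> d <= d0 -> J a b c d = J a e c d + J e b c d) ->
  (forall a b c e d, a0 <= a -> a <= b -> b <= b0 ->
    c0 <= c -> c <= e -> e <= d -> d <= d0 ->
    J a b c d = J a b c e + J a b e d) ->
  (forall x y, a0 <= x <= b0 -> c0 <= y <= d0 -> forall e : R, 0 < e ->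
    exists2 r : R, 0 < r & forall a b c d,
      a0 <= a -> b <= b0 -> c0 <= c -> d <= d0 ->
      a <= x <= b -> c <= y <= d -> b - a + (d - c) < r ->
      normc (J a b c d) <= e * (b - a + (d - c)) ^+ 2) ->
  J a0 b0 c0 d0 = 0.
Proof.
move=> ab0 cd0 splitX splitY small; apply: contrapT => /eqP J0.
have N0 : 0 < normc (J a0 b0 c0 d0) by rewrite normc_gt0.
set N := normc _ in N0.
pose L0 := b0 - a0 + (d0 - c0).
have L00 : 0 <= L0 by rewrite addr_ge0 ?subr_ge0.
(* The [+ 1] makes [e * L0 ^+ 2 < N] strict for the initial rectangle, and covers the degenerate
   case [L0 = 0]. *)
pose e := N / (L0 ^+ 2 + 1).
have e0 : 0 < e by rewrite divr_gt0 // ltr_wpDl // sqr_ge0.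
pose len (r : R * R * (R * R)) := r.1.2 - r.1.1 + (r.2.2 - r.2.1).
pose good (r : R * R * (R * R)) :=
  [/\ a0 <= r.1.1, r.1.1 <= r.1.2, r.1.2 <= b0 &
   [/\ c0 <= r.2.1, r.2.1 <= r.2.2, r.2.2 <= d0 &
       e * len r ^+ 2 < normc (J r.1.1 r.1.2 r.2.1 r.2.2)]].
pose sub (r r' : R * R * (R * R)) :=
  [/\ r.1.1 <= r'.1.1, r'.1.2 <= r.1.2, r.2.1 <= r'.2.1, r'.2.2 <= r.2.2 &
      len r' = len r / 2].
have half r : good r -> exists r', good r' /\ sub r r'.
  case: r => [[a b] [c d]] [/= aa ab bb [cc cd dd big]].
  have [ma mb] : a <= (a + b) / 2 /\ (a + b) / 2 <= b by split; lra.
  have [mc md] : c <= (c + d) / 2 /\ (c + d) / 2 <= d by split; lra.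
  set m := (a + b) / 2 in ma mb *; set k := (c + d) / 2 in mc md *.
  have am : a0 <= m by exact: le_trans ma.
  have bm : m <= b0 by exact: le_trans bb.
  have ck : c0 <= k by exact: le_trans mc.
  have dk : k <= d0 by exact: le_trans dd.
  pose l := b - a + (d - c).
  have E : J a b c d = J a m c k + J a m k d + (J m b c k + J m b k d).
    by rewrite (splitX a m) // (splitY a m c k) // (splitY m b c k).
  have disj : [\/ e * (l / 2) ^+ 2 < normc (J a m c k),
      e * (l / 2) ^+ 2 < normc (J a m k d),
      e * (l / 2) ^+ 2 < normc (J m b c k) |
      e * (l / 2) ^+ 2 < normc (J m b k d)].
    have [|h1] := ltP (e * (l / 2) ^+ 2) (normc (J a m c k)); first by constructor 1.
    have [|h2] := ltP (e * (l / 2) ^+ 2) (normc (J a m k d)); first by constructor 2.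
    have [|h3] := ltP (e * (l / 2) ^+ 2) (normc (J m b c k)); first by constructor 3.
    have [|h4] := ltP (e * (l / 2) ^+ 2) (normc (J m b k d)); first by constructor 4.
    move: big; rewrite E ltNge => /negP[].
    apply: le_trans (le_normcD _ _) _.
    have /le_trans -> // := lerD (le_normcD (J a m c k) (J a m k d))
       (le_normcD (J m b c k) (J m b k d)).
    have -> : e * len (a, b, (c, d)) ^+ 2 =
      e * (l / 2) ^+ 2 + e * (l / 2) ^+ 2 + (e * (l / 2) ^+ 2 + e * (l / 2) ^+ 2).
      by rewrite /len /l /=; field.
    by rewrite !lerD.
  have Em : m = (a + b) / 2 by [].
  have Ek : k = (c + d) / 2 by [].
  have q1 : m - a + (k - c) = l / 2 by rewrite /l; lra.
  have q2 : m - a + (d - k) = l / 2 by rewrite /l; lra.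
  have q3 : b - m + (k - c) = l / 2 by rewrite /l; lra.
  have q4 : b - m + (d - k) = l / 2 by rewrite /l; lra.
  case: disj => h; [exists (a, m, (c, k))|exists (a, m, (k, d))|
    exists (m, b, (c, k))|exists (m, b, (k, d))];
    by rewrite /good /sub /len /= ?(q1, q2, q3, q4).
have [nxt nxtP] : {nxt & forall r, good r -> good (nxt r) /\ sub r (nxt r)}.
  by apply: (@choice _ _ (fun r r' => good r -> good r' /\ sub r r')) => r;
  have [/half[r' ?]|?] := pselect (good r); [exists r'|exists r].
pose s n := iter n nxt (a0, b0, (c0, d0)).
have sg n : good (s n).
  elim: n => [|n /nxtP[]//]; split => //; split => //=.
  rewrite -/N /len /= -/L0 /e mulrAC ltr_pdivrMr ?ltr_wpDl ?sqr_ge0 //.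
  by rewrite ltr_pM2l // ltrDl.
have ss n : sub (s n) (s n.+1) by have [] := nxtP _ (sg n).
have mono (u : nat -> R) : (forall n, u n <= u n.+1) -> forall m n, (m <= n)%N -> u m <= u n.
  by move=> /nondecreasing_seqP uS m n; exact: uS.
have nest (lo hi : nat -> R) : (forall n, lo n <= lo n.+1) ->
    (forall n, hi n.+1 <= hi n) -> (forall n, lo n <= hi n) ->
    exists x, forall n, lo n <= x <= hi n.
  move=> los his lohi.
  have ub m n : lo m <= hi n.
    have h1 := mono lo los m (maxn m n) (leq_maxl _ _).
    have h2 := mono (fun n => - hi n) (fun n => ltac:(by rewrite lerN2)) n (maxn m n) (leq_maxr _ _).
    by rewrite (le_trans h1) // (le_trans (lohi _)) // -lerN2.
  exists (sup (range lo)) => n; apply/andP; split.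
    apply: ub_le_sup; last by exists n.
    by exists (hi 0) => _ [m _ <-].
  by apply: ge_sup; [exists (lo 0), 0|move=> _ [m _ <-]].
have [x xP] : exists x, forall n, (s n).1.1 <= x <= (s n).1.2.
  by apply: nest => n; [case: (ss n)|case: (ss n)|case: (sg n)].
have [y yP] : exists y, forall n, (s n).2.1 <= y <= (s n).2.2.
  by apply: nest => n; [case: (ss n)|case: (ss n)|case: (sg n) => _ _ _ []].
have lenE n : len (s n) = L0 / 2 ^+ n.
  elim: n => [|n IH]; first by rewrite divr1.
  by have [_ _ _ _ ->] := ss n; rewrite IH exprS invfM mulrA mulrAC.
have [r r0 rP] := small x y (xP 0) (yP 0) e e0.
have [n nP] : exists n, len (s n) < r.
  exists (Num.truncn (L0 / r)).+1; rewrite lenE ltr_pdivrMr ?exprn_gt0 //.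
  rewrite mulrC -ltr_pdivrMr // (lt_le_trans (truncnS_gt _)) //.
  by rewrite -natrX ler_nat ltnW // ltn_expl.
have [h1 h2 h3 [h4 h5 h6]] := sg n; rewrite ltNge => /negP[].
exact: rP.
Qed.

(** Continuity is two-sided, also at the end points: the integrands come from functions continuous
    at the points of the segment as points of the plane. It passes to subsegments without subspace
    topologies. *)
Definition continuous_seg (R : realType) (a b : R) (g : R -> R[i]) :=
  forall t, a <= t <= b -> {for t, continuous (g : R -> R[i]^o)}.

Definition cintegral (R : realType) (a b : R) (g : R -> R[i]) : R[i] :=
  ((\int[@lebesgue_measure R]_(t in `[a, b]) Re (g t))%R +i*
   (\int[@lebesgue_measure R]_(t in `[a, b]) Im (g t))%R)%C.

Lemma segment_integrable (R : realType) (a b : R) (h : R -> R) :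
  (forall t, a <= t <= b -> {for t, continuous h}) ->
  (@lebesgue_measure R).-integrable `[a, b] (EFin \o h).
Proof.
move=> ch; apply: continuous_compact_integrable; first exact: segment_compact.
by apply: continuous_in_subspaceT => t; rewrite inE /= in_itv /=; exact: ch.
Qed.

Lemma continuous_seg_Re (R : realType) (a b : R) (g : R -> R[i]) :
  continuous_seg a b g ->
  forall t, a <= t <= b -> {for t, continuous (fun t => Re (g t))}.
Proof.
move=> cg t tab; apply: (@continuous_comp _ R[i]^o R g (@complex.Re R)).
  exact: cg.
exact: Re_continuous.
Qed.

Lemma continuous_seg_Im (R : realType) (a b : R) (g : R -> R[i]) :
  continuous_seg a b g ->
  forall t, a <= t <= b -> {for t, continuous (fun t => Im (g t))}.
Proof.
move=> cg t tab; apply: (@continuous_comp _ R[i]^o R g (@complex.Im R)).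
  exact: cg.
exact: Im_continuous.
Qed.

Lemma Rintegral_split (R : realType) (a e b : R) (h : R -> R) :
  a <= e -> e <= b -> (forall t, a <= t <= b -> {for t, continuous h}) ->
  \int[@lebesgue_measure R]_(t in `[a, b]) h t =
  \int[@lebesgue_measure R]_(t in `[a, e]) h t +
  \int[@lebesgue_measure R]_(t in `[e, b]) h t.
Proof.
move=> ae eb ch; have ih := segment_integrable ch.
have := @Rintegral_itvB R h (BLeft a) (BRight b) e ih.
rewrite !bnd_simp => /(_ ae eb).
rewrite Rintegral_itv_obnd_cbnd; last first.
  apply: integrableS ih => //; apply: subset_itvr; by rewrite bnd_simp.
by move=> <-; rewrite addrC subrK.
Qed.

Lemma cintegral_split (R : realType) (a e b : R) (g : R -> R[i]) :
  a <= e -> e <= b -> continuous_seg a b g ->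
  cintegral a b g = cintegral a e g + cintegral e b g.
Proof.
move=> ae eb cg; apply/eqP; rewrite eq_complex cReD cImD /=.
rewrite (Rintegral_split ae eb (continuous_seg_Re cg)).
by rewrite (Rintegral_split ae eb (continuous_seg_Im cg)) !eqxx.
Qed.

Lemma continuous_segZ (R : realType) (a b : R) k (g : R -> R[i]) :
  continuous_seg a b g -> continuous_seg a b (fun t => k * g t).
Proof.
by move=> cg t tab; apply: (@continuousM R[i] R (fun=> k) g); [exact: cst_continuous|exact: cg].
Qed.

Lemma continuous_segB (R : realType) (a b : R) (g h : R -> R[i]) :
  continuous_seg a b g -> continuous_seg a b h ->
  continuous_seg a b (fun t => g t - h t).
Proof.
by move=> cg ch t tab; apply: (@continuousB _ R[i]^o R g h); [exact: cg|exact: ch].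
Qed.

Lemma eq_cintegral (R : realType) (a b : R) (g h : R -> R[i]) :
  (forall t, a <= t <= b -> g t = h t) -> cintegral a b g = cintegral a b h.
Proof.
move=> gh; apply/eqP; rewrite eq_complex /=; apply/andP; split; apply/eqP;
  by apply: eq_Rintegral => t; rewrite inE /= in_itv /= => /gh ->.
Qed.

Lemma cintegralD (R : realType) (a b : R) (g h : R -> R[i]) :
  continuous_seg a b g -> continuous_seg a b h ->
  cintegral a b (fun t => g t + h t) = cintegral a b g + cintegral a b h.
Proof.
move=> cg ch; apply/eqP; rewrite eq_complex cReD cImD /=.
have r1 := segment_integrable (continuous_seg_Re cg).
have r2 := segment_integrable (continuous_seg_Re ch).
have i1 := segment_integrable (continuous_seg_Im cg).
have i2 := segment_integrable (continuous_seg_Im ch).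
rewrite -(RintegralD _ r1 r2) // -(RintegralD _ i1 i2) //.
apply/andP; split; apply/eqP; apply: eq_Rintegral => t _; by rewrite ?cReD ?cImD.
Qed.

Lemma cintegralZ (R : realType) (a b : R) k (g : R -> R[i]) :
  continuous_seg a b g ->
  cintegral a b (fun t => k * g t) = k * cintegral a b g.
Proof.
move=> cg; apply/eqP; rewrite eq_complex cReM cImM /=.
have r1 := segment_integrable (continuous_seg_Re cg).
have i1 := segment_integrable (continuous_seg_Im cg).
rewrite -!(RintegralZl _ _ r1) // -!(RintegralZl _ _ i1) //.
rewrite -RintegralB //; last 2 first.
- exact: (integrableZl _ (Re k) r1).
- exact: (integrableZl _ (Im k) i1).
rewrite -RintegralD //; last 2 first.
- exact: (integrableZl _ (Re k) i1).
- exact: (integrableZl _ (Im k) r1).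
apply/andP; split; apply/eqP; apply: eq_Rintegral => t _; by rewrite ?cReM ?cImM.
Qed.

Lemma cintegralB (R : realType) (a b : R) (g h : R -> R[i]) :
  continuous_seg a b g -> continuous_seg a b h ->
  cintegral a b (fun t => g t - h t) = cintegral a b g - cintegral a b h.
Proof.
move=> cg ch; rewrite -[X in _ - X]mul1r -mulNr -cintegralZ // -cintegralD //.
  by apply: eq_cintegral => t _; rewrite mulN1r.
exact: continuous_segZ.
Qed.

Lemma Rintegral_segment_cst (R : realType) (a b k : R) : a <= b ->
  \int[@lebesgue_measure R]_(t in `[a, b]) k = k * (b - a).
Proof.
move=> ab; rewrite Rintegral_cst //= lebesgue_measure_itv /= lte_fin.
by move: ab; rewrite le_eqVlt => /predU1P[->|->] //; rewrite ltxx subrr.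
Qed.

Lemma cintegral_cst (R : realType) (a b : R) (k : R[i]) : a <= b ->
  cintegral a b (fun=> k) = k * real_complex R (b - a).
Proof.
move=> ab; apply/eqP; rewrite eq_complex cReM cImM /= !mulr0 subr0 add0r.
by rewrite !Rintegral_segment_cst // !eqxx.
Qed.

Lemma le_norm_Rintegral_segment (R : realType) (a b M : R) (h : R -> R) :
  a <= b -> (forall t, a <= t <= b -> {for t, continuous h}) ->
  (forall t, a <= t <= b -> `|h t| <= M) ->
  `|\int[@lebesgue_measure R]_(t in `[a, b]) h t| <= M * (b - a).
Proof.
move=> ab ch hM; have ih := segment_integrable ch.
apply: le_trans (le_normr_Rintegral _ ih) _ => //.
rewrite -Rintegral_segment_cst //; apply: le_Rintegral => //.
- by apply: segment_integrable => t tab; apply: continuous_comp;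
  [exact: ch|exact: norm_continuous].
- by apply: segment_integrable => t tab; exact: cst_continuous.
Qed.

(** The factor 2 adds the bounds for the real and the imaginary part. Such constants are harmless,
    because [max_modulus] works with powers. *)
Lemma le_normc_cintegral (R : realType) (a b M : R) (g : R -> R[i]) :
  a <= b -> continuous_seg a b g ->
  (forall t, a <= t <= b -> normc (g t) <= M) ->
  normc (cintegral a b g) <= 2 * M * (b - a).
Proof.
move=> ab cg gM; apply: le_trans (normc_le_ReIm _) _ => /=.
rewrite (_ : 2 * M * (b - a) = M * (b - a) + M * (b - a)); last by ring.
apply: lerD; apply: le_norm_Rintegral_segment => // t tab.
- exact: (continuous_seg_Re cg).
- exact: le_trans (le_Re_normc _) (gM _ tab).
- exact: (continuous_seg_Im cg).
- exact: le_trans (le_Im_normc _) (gM _ tab).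
Qed.

(* The contour integral along the boundary of [[a, b] x [c, d]], with opposite
   sides already combined: this way the integral of an affine function only
   involves constant integrands. *)
Definition rect_integral (R : realType) (f : R[i] -> R[i]) (a b c d : R) : R[i] :=
  cintegral a b (fun x => f (x +i* c)%C - f (x +i* d)%C) +
  'i%C * cintegral c d (fun y => f (b +i* y)%C - f (a +i* y)%C).

Lemma continuous_seg_hor (R : realType) (f : R[i]^o -> R[i]^o) (a b c : R) :
  (forall t, a <= t <= b -> {for (t +i* c)%C : R[i]^o, continuous f}) ->
  continuous_seg a b (fun x => f (x +i* c)%C).
Proof.
move=> cf t tab.
apply: (@continuous_comp _ R[i]^o _ (fun x : R => (x +i* c)%C : R[i]^o) f); last exact: cf.
move=> A /nbhs_normcP[e e0 eA]; apply/nbhs_ballP; exists e => // x xt.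
apply: eA; apply: le_lt_trans (normc_le_ReIm _) _.
by rewrite /= subrr normr0 addr0 distrC.
Qed.

Lemma continuous_seg_ver (R : realType) (f : R[i]^o -> R[i]^o) (a b c : R) :
  (forall t, a <= t <= b -> {for (c +i* t)%C : R[i]^o, continuous f}) ->
  continuous_seg a b (fun y => f (c +i* y)%C).
Proof.
move=> cf t tab.
apply: (@continuous_comp _ R[i]^o _ (fun x : R => (c +i* x)%C : R[i]^o) f); last exact: cf.
move=> A /nbhs_normcP[e e0 eA]; apply/nbhs_ballP; exists e => // x xt.
apply: eA; apply: le_lt_trans (normc_le_ReIm _) _.
by rewrite /= subrr normr0 add0r distrC.
Qed.

Definition continuous_rect (R : realType) (a b c d : R) (f : R[i]^o -> R[i]^o) :=
  forall x y, a <= x <= b -> c <= y <= d -> {for (x +i* y)%C : R[i]^o, continuous f}.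

Lemma continuous_rect_sub (R : realType) (a b c d a' b' c' d' : R)
    (f : R[i]^o -> R[i]^o) : a <= a' -> b' <= b -> c <= c' -> d' <= d ->
  continuous_rect a b c d f -> continuous_rect a' b' c' d' f.
Proof.
move=> aa bb cc dd cf x y /andP[h1 h2] /andP[h3 h4]; apply: cf.
  by rewrite (le_trans aa) // (le_trans h2).
by rewrite (le_trans cc) // (le_trans h4).
Qed.

Lemma continuous_rect_sides (R : realType) (a b c d : R) (f : R[i]^o -> R[i]^o) :
  a <= b -> c <= d -> continuous_rect a b c d f ->
  [/\ forall y, c <= y <= d -> continuous_seg a b (fun x => f (x +i* y)%C) &
      forall x, a <= x <= b -> continuous_seg c d (fun y => f (x +i* y)%C)].
Proof.
move=> ab cd cf; split=> [y ycd|x xab].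
  by apply: continuous_seg_hor => t tab; exact: cf.
by apply: continuous_seg_ver => t tab; exact: cf.
Qed.

Lemma rect_integral_splitX (R : realType) (f : R[i]^o -> R[i]^o) (a e b c d : R) :
  a <= e -> e <= b -> c <= d -> continuous_rect a b c d f ->
  rect_integral f a b c d = rect_integral f a e c d + rect_integral f e b c d.
Proof.
move=> ae eb cd cf; have ab := le_trans ae eb.
have [h v] := continuous_rect_sides ab cd cf.
rewrite /rect_integral (cintegral_split ae eb); last first.
  by apply: continuous_segB; apply: h; rewrite ?lexx ?cd.
rewrite [in RHS]addrACA -mulrDr -cintegralD; last 2 first.
- by apply: continuous_segB; apply: v; rewrite ?lexx ?ae ?eb ?ab.
- by apply: continuous_segB; apply: v; rewrite ?lexx ?ae ?eb ?ab.
by congr (_ + _ * _); apply: eq_cintegral => t _; ring.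
Qed.

Lemma rect_integral_splitY (R : realType) (f : R[i]^o -> R[i]^o) (a b c e d : R) :
  a <= b -> c <= e -> e <= d -> continuous_rect a b c d f ->
  rect_integral f a b c d = rect_integral f a b c e + rect_integral f a b e d.
Proof.
move=> ab ce ed cf; have cd := le_trans ce ed.
have [h v] := continuous_rect_sides ab cd cf.
rewrite /rect_integral (cintegral_split ce ed); last first.
  by apply: continuous_segB; apply: v; rewrite ?lexx ?ab.
rewrite [in RHS]addrACA -mulrDr -cintegralD; last 2 first.
- by apply: continuous_segB; apply: h; rewrite ?lexx ?ce ?ed ?cd.
- by apply: continuous_segB; apply: h; rewrite ?lexx ?ce ?ed ?cd.
by congr (_ + _ * _); apply: eq_cintegral => t _; ring.
Qed.

(** The constant is 2 for the two opposite sides in each integrand, times the 2 of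
    [le_normc_cintegral]. *)
Lemma le_normc_rect_integral (R : realType) (f : R[i]^o -> R[i]^o) (a b c d M : R) :
  a <= b -> c <= d ->
  (forall y, y = c \/ y = d -> continuous_seg a b (fun x => f (x +i* y)%C)) ->
  (forall x, x = a \/ x = b -> continuous_seg c d (fun y => f (x +i* y)%C)) ->
  (forall x, a <= x <= b -> normc (f (x +i* c)%C) <= M /\ normc (f (x +i* d)%C) <= M) ->
  (forall y, c <= y <= d -> normc (f (a +i* y)%C) <= M /\ normc (f (b +i* y)%C) <= M) ->
  normc (rect_integral f a b c d) <= 4 * M * (b - a + (d - c)).
Proof.
move=> ab cd h v hM vM; apply: le_trans (le_normcD _ _) _.
have ni : normc 'i%C = 1 :> R by rewrite /= expr0n expr1n add0r sqrtr1.
rewrite normcM ni mul1r mulrDr; apply: lerD.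
  apply: le_trans (@le_normc_cintegral _ _ _ (2 * M) _ ab _ _) _.
  - by apply: continuous_segB; apply: h; auto.
  - move=> t /hM[h1 h2]; apply: le_trans (le_normcD _ _) _.
    by rewrite normcN; lra.
  - by rewrite mulrA -natrM.
apply: le_trans (@le_normc_cintegral _ _ _ (2 * M) _ cd _ _) _.
- by apply: continuous_segB; apply: v; auto.
- move=> t /vM[h1 h2]; apply: le_trans (le_normcD _ _) _.
  by rewrite normcN; lra.
- by rewrite mulrA -natrM.
Qed.

Lemma rect_integralB (R : realType) (f g : R[i]^o -> R[i]^o) (a b c d : R) :
  (forall y, y = c \/ y = d -> continuous_seg a b (fun x => f (x +i* y)%C)) ->
  (forall x, x = a \/ x = b -> continuous_seg c d (fun y => f (x +i* y)%C)) ->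
  (forall y, y = c \/ y = d -> continuous_seg a b (fun x => g (x +i* y)%C)) ->
  (forall x, x = a \/ x = b -> continuous_seg c d (fun y => g (x +i* y)%C)) ->
  rect_integral (fun z => f z - g z) a b c d =
  rect_integral f a b c d - rect_integral g a b c d.
Proof.
move=> hf vf hg vg; rewrite /rect_integral opprD addrACA -mulrBr.
have Hf := continuous_segB (hf c (or_introl erefl)) (hf d (or_intror erefl)).
have Hg := continuous_segB (hg c (or_introl erefl)) (hg d (or_intror erefl)).
have Vf := continuous_segB (vf b (or_intror erefl)) (vf a (or_introl erefl)).
have Vg := continuous_segB (vg b (or_intror erefl)) (vg a (or_introl erefl)).
rewrite -(cintegralB Hf Hg) -(cintegralB Vf Vg).
by congr (_ + _ * _); apply: eq_cintegral => t _; ring.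
Qed.

Lemma rect_integralZ (R : realType) k (g : R[i]^o -> R[i]^o) (a b c d : R) :
  (forall y, y = c \/ y = d -> continuous_seg a b (fun x => g (x +i* y)%C)) ->
  (forall x, x = a \/ x = b -> continuous_seg c d (fun y => g (x +i* y)%C)) ->
  rect_integral (fun z => k * g z) a b c d = k * rect_integral g a b c d.
Proof.
move=> hg vg; rewrite /rect_integral mulrDr mulrCA.
have Hg := continuous_segB (hg c (or_introl erefl)) (hg d (or_intror erefl)).
have Vg := continuous_segB (vg b (or_intror erefl)) (vg a (or_introl erefl)).
rewrite -(cintegralZ k Hg) -(cintegralZ k Vg).
by congr (_ + _ * _); apply: eq_cintegral => t _; ring.
Qed.

(** The horizontal sides contribute [l * 'i * (c - d) * (b - a)], and the vertical sides its
    negative. *)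
Lemma rect_integral_affine (R : realType) (k l : R[i]) (a b c d : R) :
  a <= b -> c <= d -> rect_integral (fun z => k + l * z) a b c d = 0.
Proof.
move=> ab cd; rewrite /rect_integral.
have -> : cintegral a b (fun x => k + l * (x +i* c)%C - (k + l * (x +i* d)%C)) =
    cintegral a b (fun=> l * ('i%C * real_complex R (c - d))).
  apply: eq_cintegral => t _.
  rewrite (complexE (t +i* c)%C) (complexE (t +i* d)%C) /= rmorphB /=; ring.
have -> : cintegral c d (fun y => k + l * (b +i* y)%C - (k + l * (a +i* y)%C)) =
    cintegral c d (fun=> l * real_complex R (b - a)).
  apply: eq_cintegral => t _.
  rewrite (complexE (a +i* t)%C) (complexE (b +i* t)%C) /= rmorphB /=; ring.
rewrite !cintegral_cst // !rmorphB /=; ring.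
Qed.

(** The affine approximation of [f] at the point has integral 0 and can be subtracted. The remainder
    is at most [e / 4] times the half-perimeter on the sides, and the constant 4 of
    [le_normc_rect_integral] cancels the denominator. *)
Lemma goursat_small (R : realType) (f : R[i]^o -> R[i]^o) (a0 b0 c0 d0 x y e : R) :
  continuous_rect a0 b0 c0 d0 f ->
  derivable f (x +i* y)%C 1 -> 0 < e ->
  exists2 r : R, 0 < r & forall a b c d,
      a0 <= a -> b <= b0 -> c0 <= c -> d <= d0 ->
      a <= x <= b -> c <= y <= d -> b - a + (d - c) < r ->
      normc (rect_integral f a b c d) <= e * (b - a + (d - c)) ^+ 2.
Proof.
move=> cf0 /derivable_normcP[l fl] e0.
have [r r0 rP] := fl (e / 4) (divr_gt0 e0 (ltr0n _ 4)).
exists r => // a b c d aa bb cc dd axb cyd small.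
have ab : a <= b by case/andP: axb => /le_trans; apply.
have cd : c <= d by case/andP: cyd => /le_trans; apply.
have cf := continuous_rect_sub aa bb cc dd cf0.
set w := (x +i* y)%C in rP.
have [aff [affE caff aff0]] : exists aff : R[i]^o -> R[i]^o,
    [/\ forall z, aff z = f w - l * w + l * z, (forall z, {for z, continuous aff}) &
        rect_integral aff a b c d = 0].
  exists (fun z => f w - l * w + l * z); split=> // [z|].
    apply: derivable_continuous_at; apply: derivableD; first exact: derivable_cst.
    by apply: derivableM; [exact: derivable_cst|exact: derivable_id].
  exact: rect_integral_affine.
have [hf vf] := continuous_rect_sides ab cd cf.
have caffr : continuous_rect a b c d aff by move=> *; exact: caff.
have [ha va] := continuous_rect_sides ab cd caffr.
have Hf t : t = c \/ t = d -> continuous_seg a b (fun x => f (x +i* t)%C).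
  by move=> [->|->]; apply: hf; rewrite lexx ?cd.
have Vf t : t = a \/ t = b -> continuous_seg c d (fun x => f (t +i* x)%C).
  by move=> [->|->]; apply: vf; rewrite lexx ?ab.
have Ha t : t = c \/ t = d -> continuous_seg a b (fun x => aff (x +i* t)%C).
  by move=> [->|->]; apply: ha; rewrite lexx ?cd.
have Va t : t = a \/ t = b -> continuous_seg c d (fun x => aff (t +i* x)%C).
  by move=> [->|->]; apply: va; rewrite lexx ?ab.
have -> : rect_integral f a b c d = rect_integral (fun z => f z - aff z) a b c d.
  rewrite (rect_integralB Hf Vf Ha Va).
  by rewrite aff0 subr0.
set L := b - a + (d - c) in small *.
have est u v : a <= u <= b -> c <= v <= d ->
    normc (f (u +i* v)%C - aff (u +i* v)%C) <= e / 4 * L.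
  move=> uab vcd; set z := (u +i* v)%C.
  have zw : normc (z - w) <= L.
    apply: le_trans (normc_le_ReIm _) _; rewrite /= /L.
    move: axb cyd uab vcd => /andP[? ?] /andP[? ?] /andP[? ?] /andP[? ?].
    by apply: lerD; rewrite ler_norml; apply/andP; split; lra.
  have := rP (z - w) (le_lt_trans zw small).
  have -> : f (w + (z - w)) - f w - l * (z - w) = f z - aff z.
    by rewrite affE (_ : w + (z - w) = z); ring.
  by move/le_trans; apply; rewrite ler_pM2l // divr_gt0.
have -> : e * L ^+ 2 = 4 * (e / 4 * L) * L by field.
apply: (@le_normc_rect_integral R (fun z => f z - aff z) a b c d _ ab cd).
- by move=> t tcd; exact: (continuous_segB (Hf t tcd) (Ha t tcd)).
- by move=> t tab; exact: (continuous_segB (Vf t tab) (Va t tab)).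
- by move=> t ?; split; apply: est; rewrite ?lexx ?cd.
- by move=> t ?; split; apply: est; rewrite ?lexx ?ab.
Qed.

Lemma goursat (R : realType) (f : R[i]^o -> R[i]^o) (a b c d : R) :
  a <= b -> c <= d ->
  (forall x y, a <= x <= b -> c <= y <= d -> derivable f (x +i* y)%C 1) ->
  rect_integral f a b c d = 0.
Proof.
move=> ab cd df.
have cf : continuous_rect a b c d f.
  by move=> x y xab ycd; apply: derivable_continuous_at; exact: df.
apply: (bisection_zero ab cd).
- move=> a' e b' c' d' aa ae eb bb cc cd' dd; apply: rect_integral_splitX => //.
  exact: continuous_rect_sub cf.
- move=> a' b' c' e d' aa ab' bb cc ce ed dd; apply: rect_integral_splitY => //.
  exact: continuous_rect_sub cf.
- by move=> x y xab ycd e e0; apply: goursat_small => //; exact: df.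
Qed.

(** A small square around 0 is cut out; the four rectangles left over avoid 0, and Goursat's theorem
    applies to them. Near 0 the function is bounded by continuity, so the integral over the small
    square tends to 0 with its side. *)
Lemma goursat_except (R : realType) (f : R[i]^o -> R[i]^o) (s : R) : 0 < s ->
  {for 0, continuous f} ->
  (forall z : R[i], z != 0 -> `|Re z| <= s -> `|Im z| <= s -> derivable f z 1) ->
  rect_integral f (- s) s (- s) s = 0.
Proof.
move=> s0 cf0 df.
have cf : continuous_rect (- s) s (- s) s f.
  move=> x y xs ys; have [->//|z0] := eqVneq (x +i* y)%C 0.
  by apply: derivable_continuous_at; apply: df => //=; rewrite ler_norml.
have dr x y : - s <= x <= s -> - s <= y <= s -> x != 0 \/ y != 0 ->
    derivable f (x +i* y)%C 1.
  move=> xs ys xy; apply: df; rewrite ?ler_norml //.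
  by rewrite eq_complex /= negb_and; apply/orP.
have gz a b c d : a <= b -> c <= d -> - s <= a -> b <= s -> - s <= c -> d <= s ->
    [\/ b < 0, 0 < a, d < 0 | 0 < c] -> rect_integral f a b c d = 0.
  move=> ab cd sa bs sc ds out; apply: (goursat ab cd) => x y /andP[h1 h2] /andP[h3 h4].
  apply: dr; first by apply/andP; split; lra.
    by apply/andP; split; lra.
  by case: out => h; [left; rewrite lt_eqF|left; rewrite gt_eqF|right; rewrite lt_eqF|
    right; rewrite gt_eqF] => //; lra.
have shrink t : 0 < t -> t <= s ->
    rect_integral f (- s) s (- s) s = rect_integral f (- t) t (- t) t.
  move=> t0 ts.
  have [n0 nts tt ss] : [/\ - t < 0, - s <= - t, - t <= t & - s <= s] by split; lra.
  have [nst tns] : - t <= s /\ - s <= t by split; lra.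
  have cfr a b c d : - s <= a -> b <= s -> - s <= c -> d <= s -> continuous_rect a b c d f.
    by move=> *; apply: continuous_rect_sub cf.
  rewrite (rect_integral_splitX nts nst ss cf).
  rewrite (gz (- s) (- t)) ?lexx //; last by constructor 1.
  rewrite add0r (rect_integral_splitX tt ts ss (cfr _ _ _ _ nts (lexx _) (lexx _) (lexx _))).
  rewrite (gz t s) ?lexx //; last by constructor 2.
  rewrite addr0 (rect_integral_splitY tt nts nst (cfr _ _ _ _ nts ts (lexx _) (lexx _))).
  rewrite (gz (- t) t (- s)) ?lexx //; last by constructor 3.
  rewrite add0r (rect_integral_splitY tt tt ts (cfr _ _ _ _ nts ts nts (lexx _))).
  by rewrite (gz (- t) t t) ?lexx ?addr0 //; constructor 4.
have [r r0 rP] := (continuous_normcP f 0).1 cf0 1 ltr01.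
set M := normc (f 0) + 1.
have M0 : 0 < M by rewrite ltr_wpDl ?normc_ge0.
have [//|N0] := eqVneq (rect_integral f (- s) s (- s) s) 0.
rewrite -normc_gt0 in N0; set N := normc _ in N0.
(* Points of the small square satisfy [|z| <= 2 * t <= r / 2 < r], so [M] bounds [f] there. The
   integral is then at most [4 * M * (4 * t) = 16 * M * t <= N / 2], against its value of modulus
   [N]. *)
pose t := Num.min s (Num.min (r / 4) (N / (32 * M))).
have t0 : 0 < t by rewrite !lt_min s0 !divr_gt0 // mulr_gt0.
have ts : t <= s by rewrite ge_min lexx.
have tr : t <= r / 4 by rewrite !ge_min lexx orbT.
have tN : t <= N / (32 * M) by rewrite !ge_min lexx !orbT.
have tt : - t <= t by lra.
have nts : - s <= - t by rewrite lerN2.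
have : N <= 4 * M * (t - - t + (t - - t)).
  rewrite /N (shrink t) //.
  have cft := continuous_rect_sub nts ts nts ts cf.
  have [h v] := continuous_rect_sides tt tt cft.
  have bnd x y : - t <= x <= t -> - t <= y <= t -> normc (f (x +i* y)%C) <= M.
    move=> xt yt; rewrite -lerBlDl (le_trans (ler_normcB _ _)) // ltW // rP // subr0.
    rewrite (le_lt_trans (normc_le_ReIm _)) //=.
    by move: xt yt; rewrite -!ler_norml; lra.
  apply: le_normc_rect_integral => //.
  - by move=> u [->|->]; apply: h; rewrite lexx ?tt.
  - by move=> u [->|->]; apply: v; rewrite lexx ?tt.
  - by move=> u ?; split; apply: bnd; rewrite ?lexx ?tt.
  - by move=> u ?; split; apply: bnd; rewrite ?lexx ?tt.
move: tN; rewrite ler_pdivlMr ?mulr_gt0 // => tN.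
rewrite (_ : _ * (_ + _) = (t * M) * 16); last by ring.
move: tN; rewrite (_ : t * (32 * M) = (t * M) * 32); last by ring.
have arith (u v : R) : 0 < v -> u * 32 <= v -> v <= u * 16 -> False by lra.
by move=> h1 h2; case: (arith _ _ N0 h1 h2).
Qed.

Lemma eq_rect_integral (R : realType) (f g : R[i] -> R[i]) (a b c d : R) :
  (forall x, a <= x <= b ->
    f (x +i* c)%C = g (x +i* c)%C /\ f (x +i* d)%C = g (x +i* d)%C) ->
  (forall y, c <= y <= d ->
    f (a +i* y)%C = g (a +i* y)%C /\ f (b +i* y)%C = g (b +i* y)%C) ->
  rect_integral f a b c d = rect_integral g a b c d.
Proof.
move=> h v; rewrite /rect_integral; congr (_ + _ * _).
  by apply: eq_cintegral => t /h[-> ->].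
by apply: eq_cintegral => t /v[-> ->].
Qed.

Lemma le_Im_cintegral (R : realType) (a b m : R) (g : R -> R[i]) : a <= b ->
  continuous_seg a b g -> (forall t, a <= t <= b -> m <= Im (g t)) ->
  m * (b - a) <= Im (cintegral a b g).
Proof.
move=> ab cg gm; rewrite -Rintegral_segment_cst //; apply: le_Rintegral => //.
- by apply: segment_integrable => t tab; exact: cst_continuous.
- exact: (segment_integrable (continuous_seg_Im cg)).
Qed.

Lemma le_Re_cintegral (R : realType) (a b m : R) (g : R -> R[i]) : a <= b ->
  continuous_seg a b g -> (forall t, a <= t <= b -> m <= Re (g t)) ->
  m * (b - a) <= Re (cintegral a b g).
Proof.
move=> ab cg gm; rewrite -Rintegral_segment_cst //; apply: le_Rintegral => //.
- by apply: segment_integrable => t tab; exact: cst_continuous.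
- exact: (segment_integrable (continuous_seg_Re cg)).
Qed.

Lemma derivable_inv (R : realType) (z : R[i]^o) : z != 0 ->
  derivable (fun w : R[i]^o => w^-1 : R[i]^o) z 1.
Proof. by move=> z0; apply: derivableV z0 _; exact: derivable_id. Qed.

(* The exact value is [2 * pi * 'i]. *)
Lemma normc_rect_integral_inv_ge (R : realType) (s : R) : 0 < s ->
  4 <= normc (rect_integral (fun z : R[i] => z^-1) (- s) s (- s) s).
Proof.
move=> s0; apply: le_trans (le_trans (ler_norm _) (le_Im_normc _)).
have ss : - s <= s by lra.
have nz x y : x != 0 \/ y != 0 -> (x +i* y)%C != 0 :> R[i].
  by move=> xy; rewrite eq_complex /= negb_and; apply/orP.
have cinv x y : x != 0 \/ y != 0 ->
    {for (x +i* y)%C : R[i]^o, continuous (fun w : R[i]^o => w^-1 : R[i]^o)}.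
  by move=> /nz xy; apply: derivable_continuous_at; exact: derivable_inv.
have [sn0 nsn0] : s != 0 /\ - s != 0 by rewrite oppr_eq0 gt_eqF.
(* Over each pair of opposite sides, the relevant part of the combined integrand is
   [2 * s / (t ^+ 2 + s ^+ 2)]. Each pair has length [2 * s] and contributes at least 2. *)
have bnd t : - s <= t <= s -> s^-1 <= 2 * s / (t ^+ 2 + s ^+ 2).
  move=> ts; have le2 : t ^+ 2 + s ^+ 2 <= s * (2 * s) by nra.
  have p : 0 < t ^+ 2 + s ^+ 2 by rewrite ltr_wpDl ?sqr_ge0 ?exprn_gt0.
  by rewrite ler_pdivlMr // mulrC ler_pdivrMr // mulrC.
rewrite /rect_integral cImD cImM (_ : Re 'i%C = 0) // (_ : Im 'i%C = 1) // mul0r add0r mul1r.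
have -> : 4 = s^-1 * (s - - s) + s^-1 * (s - - s) :> R by field.
apply: lerD.
  apply: le_Im_cintegral => //.
    by apply: continuous_segB; apply: continuous_seg_hor => t _; apply: cinv; right.
  move=> t ts; rewrite cImD cImN /= sqrrN.
  by rewrite (_ : _ - _ = 2 * s / (t ^+ 2 + s ^+ 2)) ?bnd //; ring.
apply: le_Re_cintegral => //.
  by apply: continuous_segB; apply: continuous_seg_ver => t _; apply: cinv; left.
move=> t ts; rewrite cReD cReN /= sqrrN.
by rewrite (_ : _ - _ = 2 * s / (t ^+ 2 + s ^+ 2)) ?bnd // [t ^+ 2 + _]addrC; ring.
Qed.

(** A Cauchy estimate with a constant. The difference quotient of [f] at 0, completed by the
    derivative, falls under [goursat_except]; hence the integral of [f z / z] is [f 0] times that of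
    [1 / z]. On the sides [|z| >= s], so the former is at most [4 * (M / s) * (4 * s) = 16 * M],
    while the integral of [1 / z] has modulus at least 4. *)
Lemma center_bound (R : realType) (f : R[i]^o -> R[i]^o) (s M : R) : 0 < s ->
  (forall z : R[i], `|Re z| <= s -> `|Im z| <= s -> derivable f z 1) ->
  (forall z : R[i], `|Re z| <= s -> `|Im z| <= s -> `|Re z| = s \/ `|Im z| = s ->
    normc (f z) <= M) ->
  normc (f 0) <= 4 * M.
Proof.
move=> s0 df fM.
have ss : - s <= s by lra.
have zs (x y : R) : - s <= x <= s -> - s <= y <= s -> derivable f (x +i* y)%C 1.
  by move=> xs ys; apply: df; rewrite /= ler_norml.
have /derivable_normcP[l fl] : derivable f 0 1.
  by apply: df; rewrite /= normr0 ltW.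
pose g (z : R[i]^o) : R[i]^o := if z == 0 then l else (f z - f 0) * z^-1.
have cg0 : {for 0, continuous g}.
  apply/continuous_normcP => e e0.
  have [d d0 dP] := fl (e / 2) (divr_gt0 e0 (ltr0n _ 2)).
  exists d => // w; rewrite subr0 => wd; rewrite /g eqxx.
  have [_|w0] := eqVneq w 0; first by rewrite subrr normc0.
  have := dP w wd; rewrite add0r.
  have -> : f w - f 0 - l * w = ((f w - f 0) * w^-1 - l) * w.
    by rewrite mulrBl mulfVK.
  rewrite normcM ler_pM2r ?normc_gt0 // => /le_lt_trans; apply.
  by rewrite ltr_pdivrMr // ltr_pMr // ltr1n.
have dg (z : R[i]) : z != 0 -> `|Re z| <= s -> `|Im z| <= s -> derivable g z 1.
  move=> z0 zr zi.
  apply: (@near_eq_derivable _ _ _ (fun z : R[i]^o => (f z - f 0) * z^-1 : R[i]^o)).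
    apply/nbhs_normcP; exists (normc z); first by rewrite normc_gt0.
    move=> w wz; rewrite /g; have [w0|//] := eqVneq w 0.
    by move: wz; rewrite w0 sub0r normcN ltxx.
  apply: derivableM; last exact: derivable_inv.
  by apply: derivableB; [exact: df|exact: derivable_cst].
have := goursat_except s0 cg0 dg.
have nzl (x y : R) : x != 0 \/ y != 0 -> (x +i* y)%C != 0 :> R[i].
  by move=> xy; rewrite eq_complex /= negb_and; apply/orP.
have [sn0 nsn0] : s != 0 /\ - s != 0 by rewrite oppr_eq0 gt_eqF.
pose h (z : R[i]^o) : R[i]^o := f z * z^-1.
have gE (x y : R) : x != 0 \/ y != 0 ->
    g (x +i* y)%C = h (x +i* y)%C - f 0 * (x +i* y)%C^-1.
  by move=> /nzl /negbTE xy; rewrite /g xy mulrBl.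
rewrite (@eq_rect_integral _ _ (fun z => h z - f 0 * z^-1)); last 2 first.
- by move=> x _; split; apply: gE; right.
- by move=> x _; split; apply: gE; left.
have ci (x y : R) : x != 0 \/ y != 0 ->
    {for (x +i* y)%C : R[i]^o, continuous (fun w : R[i]^o => w^-1 : R[i]^o)}.
  by move=> /nzl xy; apply: derivable_continuous_at; exact: derivable_inv.
have ch (x y : R) : - s <= x <= s -> - s <= y <= s -> x != 0 \/ y != 0 ->
    {for (x +i* y)%C : R[i]^o, continuous h}.
  move=> xs ys xy; apply: (@continuousM R[i] R[i]^o f); last exact: ci.
  by apply: derivable_continuous_at; exact: zs.
have Hi y : y = - s \/ y = s -> continuous_seg (- s) s (fun x => (x +i* y)%C^-1).
  by move=> ys; apply: continuous_seg_hor => t _; apply: ci; right; case: ys => ->.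
have Vi x : x = - s \/ x = s -> continuous_seg (- s) s (fun y => (x +i* y)%C^-1).
  by move=> xs; apply: continuous_seg_ver => t _; apply: ci; left; case: xs => ->.
have Hh y : y = - s \/ y = s -> continuous_seg (- s) s (fun x => h (x +i* y)%C).
  move=> ys; apply: continuous_seg_hor => t ts; apply: ch => //.
    by case: ys => ->; rewrite lexx ss.
  by right; case: ys => ->.
have Vh x : x = - s \/ x = s -> continuous_seg (- s) s (fun y => h (x +i* y)%C).
  move=> xs; apply: continuous_seg_ver => t ts; apply: ch => //.
    by case: xs => ->; rewrite lexx ss.
  by left; case: xs => ->.
have Hi' y (ys : y = - s \/ y = s) := continuous_segZ (k := f 0) (Hi y ys).
have Vi' y (ys : y = - s \/ y = s) := continuous_segZ (k := f 0) (Vi y ys).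
rewrite (@rect_integralB _ h (fun z => f 0 * z^-1) _ _ _ _ Hh Vh Hi' Vi').
rewrite (@rect_integralZ _ (f 0) (fun z => z^-1) _ _ _ _ Hi Vi).
move/eqP; rewrite subr_eq0 => /eqP hf.
have sa : `|s| = s by rewrite ger0_norm // ltW.
have M0 : 0 <= M.
  apply: le_trans (normc_ge0 _) (fM (s +i* s)%C _ _ _); rewrite /= sa //.
  by left.
have hM (x y : R) : - s <= x <= s -> - s <= y <= s -> `|x| = s \/ `|y| = s ->
    normc (h (x +i* y)%C) <= M / s.
  move=> xs ys xy; rewrite /h normcM normcV; apply: ler_pM.
  - exact: normc_ge0.
  - by rewrite invr_ge0 normc_ge0.
  - by apply: fM; rewrite /= ?ler_norml.
  - have sn : s <= normc (x +i* y)%C.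
      case: xy => <-; [exact: (le_Re_normc (x +i* y)%C)|exact: (le_Im_normc (x +i* y)%C)].
    by rewrite lef_pV2 // posrE // (lt_le_trans s0).
have nsa : `|- s| = s by rewrite normrN.
have : normc (rect_integral h (- s) s (- s) s) <= 4 * (M / s) * (s - - s + (s - - s)).
  apply: (@le_normc_rect_integral _ h _ _ _ _ (M / s) ss ss Hh Vh) => t ts.
    by split; apply: hM; rewrite ?lexx ?ss //; right.
  by split; apply: hM; rewrite ?lexx ?ss //; left.
rewrite hf normcM (_ : _ * (_ + _) = 16 * M); last by field.
move=> le16; have := normc_rect_integral_inv_ge s0.
have arith (u v : R) : 0 <= u -> 4 <= v -> u * v <= 16 * M -> u <= 4 * M.
  by move=> *; nra.
move=> h4; exact: arith (normc_ge0 _) h4 le16.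
Qed.

(** * The maximum principle *)

Lemma derivable_compc (R : realType) (f g : R[i]^o -> R[i]^o) (z : R[i]^o) :
  derivable g z 1 -> derivable f (g z) 1 -> derivable (fun w => f (g w)) z 1.
Proof.
move=> /derivable1_diffP dg /derivable1_diffP df; apply/derivable1_diffP.
exact: (differentiable_comp dg df).
Qed.

Lemma derivable_affine (R : realType) (k l : R[i]) (z : R[i]^o) :
  derivable (fun w : R[i]^o => k + l * w : R[i]^o) z 1.
Proof.
apply: derivableD; first exact: derivable_cst.
by apply: derivableM; [exact: derivable_cst|exact: derivable_id].
Qed.

Lemma exists_expr_lt (R : realType) (q e : R) : 0 <= q -> q < 1 -> 0 < e ->
  exists n, q ^+ n < e.
Proof.
move=> q0 q1 e0; have /cvg_expr/cvgr0Pnorm_lt/(_ e e0) [N _ /(_ N (leqnn N))] : `|q| < 1.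
  by rewrite ger0_norm.
by rewrite /= ger0_norm ?exprn_ge0 // => ?; exists N.
Qed.

(* At the rightmost point [z0] where the maximum is attained, the product of the
   four rotations of [f] about [z0] is smaller on every side of a small square
   than at its centre; taking powers removes the constant of [center_bound]. *)
Lemma max_modulus (R : realType) (A : set R[i]^o) (f : R[i]^o -> R[i]^o) (M : R) :
  open A -> 0 <= M -> (forall z, A z -> derivable f z 1) ->
  (forall M', M < M' -> exists K : set R[i]^o, [/\ compact K, K `<=` A &
     forall z, A z -> ~ K z -> normc (f z) <= M']) ->
  forall z, A z -> normc (f z) <= M.
Proof.
move=> oA M0 df hK z1 Az1; rewrite leNgt; apply/negP => Mz1.
(* At a level strictly between [M] and [|f z1|], all points of larger modulus lie in the compact
   [K]. Hence the supremum over [A] is attained, in [K]. *)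
have [K [cK KA KM]] := hK _ (midf_lt Mz1).1.
set M' := (M + _) / 2 in KM; have M'z1 : M' < normc (f z1) := (midf_lt Mz1).2.
have MM' : M < M' := (midf_lt Mz1).1.
have inK z : A z -> M' < normc (f z) -> K z.
  by move=> Az zM; apply: contrapT => /(KM z Az); rewrite leNgt zM.
have cf z : A z -> {for z, continuous f} by move=> /df; exact: derivable_continuous_at.
have cnf z : A z -> {for z, continuous (fun w : R[i]^o => normc (f w) : R)}.
  move=> /cf cfz; apply: (@continuous_comp R[i]^o R[i]^o R f (@normc R)) => //.
  exact: normc_continuous.
have [||c /[!inE] Kc cmax] := @compact_EVT_max R[i]^o R (fun w => normc (f w)) K _ cK.
- by exists z1; exact: inK.
- by apply: continuous_in_subspaceT => z /[!inE] /KA; exact: cnf.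
set M1 := normc (f c) in cmax.
have {}cmax z : A z -> normc (f z) <= M1.
  move=> Az; have [Kz|nKz] := pselect (K z); first by apply: cmax; rewrite inE.
  apply: le_trans (KM z Az nKz) _; apply: ltW; apply: (lt_le_trans M'z1).
  by apply: cmax; rewrite inE; exact: inK.
have M'M1 : M' < M1 by apply: (lt_le_trans M'z1); exact: cmax.
have M10 : 0 < M1 by apply: le_lt_trans M0 (lt_trans MM' M'M1).
(* The set of all maximum points. It is compact, which is what provides a rightmost one. *)
pose T : set R[i]^o := [set z | K z /\ normc (f z) = M1].
have cT : compact T.
  apply: (@subclosed_compact _ T K) => //; last by move=> z [].
  rewrite -[T]setCK; apply: open_closedC; rewrite openE => z /not_andP nTz.
  have [Kz|nKz] := pselect (K z).
    have fz : normc (f z) < M1.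
      by rewrite lt_neqAle cmax ?andbT; [apply/eqP; case: nTz|exact: KA].
    have h : nbhs (z : R[i]^o) [set w : R[i]^o | normc (f w) < M1].
      exact: (cnf z (KA z Kz) _ (lt_nbhsl fz)).
    rewrite /interior; apply: filterS h => w /= wM1 [_ wE].
    by rewrite wE ltxx in wM1.
  have : open (~` K) by apply: closed_openC; exact: compact_closed (@normc_hausdorff R) cK.
  by rewrite openE => /(_ z nKz) h; apply: filterS h => w nKw [].
have [||z0 /[!inE] -[Kz0 fz0] z0max] := @compact_EVT_max R[i]^o R (@complex.Re R) T _ cT.
- by exists c; split.
- by apply: continuous_subspaceT; exact: Re_continuous.
have [e e0 eA] := (open_normcP A).1 oA z0 (KA _ Kz0).
pose s := e / 4; have s0 : 0 < s by rewrite divr_gt0.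
have sqA (z : R[i]) : `|Re z| <= s -> `|Im z| <= s -> A (z0 + z).
  move=> zr zi; apply: eA; rewrite (_ : z0 + z - z0 = z); last by ring.
  by apply: le_lt_trans (normc_le_ReIm z) _; move: zr zi; rewrite /s; lra.
have df0 (u : R[i]) (z : R[i]^o) : `|Re (u * z)| <= s -> `|Im (u * z)| <= s ->
    derivable (fun w : R[i]^o => f (z0 + u * w)) z 1.
  move=> zr zi; apply: (@derivable_compc _ f (fun w : R[i]^o => z0 + u * w)).
    exact: derivable_affine.
  exact/df/sqA.
(* The right side of the square lies strictly to the right of [z0], hence contains no point of [T];
   by compactness the maximum [M2] over this side is below [M1]. *)
have [M2 [M2M1 M20 rightM2]] : exists M2, [/\ M2 < M1, 0 <= M2 &
    forall z : R[i], Re z = s -> `|Im z| <= s -> normc (f (z0 + z)) <= M2].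
  pose S : set R[i]^o := [set z : R[i] | s <= Re z <= s /\ - s <= Im z <= s].
  have S0 : S (s +i* 0)%C by rewrite /S /= lexx; split => //; lra.
  have SA z : S z -> A (z0 + z).
    move=> [zr zi]; apply: sqA; last by rewrite ler_norml.
    by rewrite ler_norml; lra.
  have [||w /[!inE] Sw wmax] := @compact_EVT_max R[i]^o R (fun w : R[i]^o => normc (f (z0 + w))) S _
      (@compact_rect R s s (- s) s).
  - by exists (s +i* 0)%C.
  - apply: continuous_in_subspaceT => z /[!inE] Sz.
    apply: (@continuous_comp R[i]^o R[i]^o R (fun w : R[i]^o => z0 + w) (fun w : R[i]^o => normc (f w))).
      apply: derivable_continuous_at; apply: derivableD; first exact: derivable_cst.
      exact: derivable_id.
    exact/cnf/SA.
  exists (normc (f (z0 + w))); split; rewrite ?normc_ge0 //.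
    rewrite lt_neqAle cmax ?andbT; last exact: SA.
    apply/negP => /eqP wM1.
    have : T (z0 + w) by split => //; apply: inK; [exact: SA|rewrite wM1].
    rewrite -inE => /z0max; rewrite cReD => le0.
    by case: Sw => /andP[sw _] _; lra.
  move=> z zr zi; apply: wmax; rewrite inE /S /= zr lexx; split => //.
  by rewrite -ler_norml.
pose g (z : R[i]^o) : R[i]^o := f (z0 + 1 * z) * f (z0 + 'i%C * z) *
  (f (z0 + (-1) * z) * f (z0 + (- 'i%C) * z)).
have Rei (z : R[i]) : Re ('i%C * z) = - Im z by rewrite mulrC ReiNIm.
have Imi (z : R[i]) : Im ('i%C * z) = Re z by rewrite mulrC ImiRe.
have dg k (z : R[i]^o) : `|Re z| <= s -> `|Im z| <= s -> derivable (g ^+ k) z 1.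
  move=> zr zi; apply: derivableX; apply: derivableM; apply: derivableM; apply: df0;
  by rewrite ?mulNr ?mul1r ?cReN ?cImN ?Rei ?Imi ?normrN.
have gM (z : R[i]) : `|Re z| <= s -> `|Im z| <= s -> `|Re z| = s \/ `|Im z| = s ->
    normc (g z) <= M1 ^+ 3 * M2.
  move=> zr zi zs; rewrite /g !normcM !mulNr !mul1r.
  have b1 : normc (f (z0 + z)) <= M1 by apply/cmax/sqA.
  have b2 : normc (f (z0 + 'i%C * z)) <= M1.
    by apply/cmax/sqA; rewrite ?Rei ?Imi ?normrN.
  have b3 : normc (f (z0 - z)) <= M1.
    by apply/cmax/sqA; rewrite ?cReN ?cImN ?normrN.
  have b4 : normc (f (z0 - 'i%C * z)) <= M1.
    by apply/cmax/sqA; rewrite ?cReN ?cImN ?Rei ?Imi ?normrN.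
  have prod4 (x1 x2 x3 x4 y1 y2 y3 y4 : R) : 0 <= x1 -> 0 <= x2 -> 0 <= x3 -> 0 <= x4 ->
      x1 <= y1 -> x2 <= y2 -> x3 <= y3 -> x4 <= y4 ->
      x1 * x2 * (x3 * x4) <= y1 * y2 * (y3 * y4).
    by move=> *; rewrite !ler_pM // ?mulr_ge0.
  have [E|E|E|E] : [\/ Re z = s, Re z = - s, Im z = - s | Im z = s].
    case: zs; rewrite -[X in _ = X -> _](gtr0_norm s0) => /eqP; rewrite eqr_norm2 => /orP[]/eqP ->.
    - by constructor 1.
    - by constructor 2.
    - by constructor 4.
    - by constructor 3.
  - rewrite (_ : M1 ^+ 3 * M2 = M2 * M1 * (M1 * M1)); last by ring.
    by apply: prod4; rewrite ?normc_ge0 // rightM2.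
  - rewrite (_ : M1 ^+ 3 * M2 = M1 * M1 * (M2 * M1)); last by ring.
    apply: prod4; rewrite ?normc_ge0 // rightM2 // ?cReN ?cImN ?E ?opprK ?normrN //.
  - rewrite (_ : M1 ^+ 3 * M2 = M1 * M2 * (M1 * M1)); last by ring.
    by apply: prod4; rewrite ?normc_ge0 // rightM2 // ?Rei ?Imi ?E ?opprK.
  - rewrite (_ : M1 ^+ 3 * M2 = M1 * M1 * (M1 * M2)); last by ring.
    by apply: prod4; rewrite ?normc_ge0 // rightM2 // ?cReN ?cImN ?Rei ?Imi ?E ?opprK ?normrN.
(* For [g ^+ k], [center_bound] gives [M1 ^ (4 k) <= 4 * (M1 ^ 3 * M2) ^ k], that is
   [1 / 4 <= (M2 / M1) ^ k]. *)
have [k qk] : exists k, (M2 / M1) ^+ k < 1 / 4.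
  apply: exists_expr_lt; last by rewrite divr_gt0.
    by rewrite divr_ge0 // ltW.
  by rewrite ltr_pdivrMr // mul1r.
have gkE z : (g ^+ k) z = g z ^+ k.
  by elim: k {qk} => [|k IH] //; rewrite !exprS -IH.
have hb (z : R[i]) : `|Re z| <= s -> `|Im z| <= s -> `|Re z| = s \/ `|Im z| = s ->
    normc ((g ^+ k) z) <= (M1 ^+ 3 * M2) ^+ k.
  move=> zr zi zs; rewrite gkE normcX.
  apply: lerXn2r; rewrite ?nnegrE ?normc_ge0 ?mulr_ge0 ?exprn_ge0 ?(ltW M10) //.
  exact: gM.
have := center_bound s0 (dg k) hb.
rewrite gkE normcX /g !mulr0 addr0 !normcM fz0.
rewrite (_ : M1 * M1 * (M1 * M1) = M1 ^+ 3 * M1); last by ring.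
have := exprn_gt0 3 M10; move: (M1 ^+ 3) => m3 m30.
rewrite !exprMn mulrCA ler_pM2l ?exprn_gt0 // => le4.
move: qk; rewrite expr_div_n ltr_pdivrMr ?exprn_gt0 // => lt4.
by move: le4 lt4; set u := M1 ^+ k; set v := M2 ^+ k; lra.
Qed.

(** * Exterior maps *)

Lemma continuous_normcB (R : realType) (c : R[i]) :
  continuous (fun z : R[i]^o => normc (z - c) : R).
Proof.
move=> z; apply: (@continuous_comp R[i]^o R[i]^o R (fun w : R[i]^o => w - c) (@normc R)).
  apply: derivable_continuous_at; apply: derivableB; first exact: derivable_id.
  exact: derivable_cst.
exact: normc_continuous.
Qed.

Lemma closed_normc_le (R : realType) (c : R[i]) (s : R) :
  closed ([set z | normc (z - c) <= s] : set R[i]^o).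
Proof.
apply: (@closed_comp R[i]^o R (fun z => normc (z - c)) [set x | x <= s]).
  by move=> z _; exact: continuous_normcB.
exact: closed_le.
Qed.

Lemma closed_normc_ge (R : realType) (c : R[i]) (s : R) :
  closed ([set z | s <= normc (z - c)] : set R[i]^o).
Proof.
apply: (@closed_comp R[i]^o R (fun z => normc (z - c)) [set x | s <= x]).
  by move=> z _; exact: continuous_normcB.
exact: closed_ge.
Qed.

(** Also used with [s = t], for a circle, and with [s = 0], for a closed disc. *)
Lemma compact_annulus (R : realType) (c : R[i]) (s t : R) :
  compact ([set z | s <= normc (z - c) /\ normc (z - c) <= t] : set R[i]^o).
Proof.
apply: (@closed_bounded_compact _ _ (normc c + t)).
  exact: (closedI (@closed_normc_ge _ c s) (@closed_normc_le _ c t)).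
move=> z [_ zt]; rewrite -[z](subrK c) addrC.
by apply: le_trans (le_normcD _ _) _; rewrite lerD2l.
Qed.

Lemma open_normc_lt (R : realType) (c : R[i]) (s : R) :
  open ([set z | normc (z - c) < s] : set R[i]^o).
Proof.
rewrite (_ : mkset _ = ~` [set z | s <= normc (z - c)]).
  by apply: closed_openC; exact: closed_normc_ge.
by apply/seteqP; split => z /=; rewrite ltNge => /negP.
Qed.

Lemma continuous_at_normcB (R : realType) (f : R[i]^o -> R[i]^o) (w : R[i]) (z : R[i]^o) :
  {for z, continuous f} -> {for z, continuous (fun u : R[i]^o => normc (f u - w) : R)}.
Proof.
move=> cf; apply: (@continuous_comp R[i]^o R[i]^o R f (fun v => normc (v - w))) => //.
exact: continuous_normcB.
Qed.

(* Otherwise [1 / (f - w)] would violate the maximum principle. *)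
Lemma value_in_disc (R : realType) (f : R[i]^o -> R[i]^o) (c w : R[i]) (s e : R) :
  0 < s -> 0 < e ->
  (forall z : R[i], normc (z - c) <= s -> derivable f z 1) ->
  (forall z : R[i], normc (z - c) = s -> e <= normc (f z - w)) ->
  normc (f c - w) < e -> exists2 z, normc (z - c) < s & f z = w.
Proof.
move=> s0 e0 df fs fc; apply: contrapT => nex.
have fw (z : R[i]) : normc (z - c) < s -> f z - w != 0.
  by move=> zs; rewrite subr_eq0; apply/eqP => fz; apply: nex; exists z.
have cc : normc (c - c) < s by rewrite subrr normc0.
pose h (z : R[i]^o) : R[i]^o := (f z - w)^-1.
have := @max_modulus R [set z | normc (z - c) < s] h e^-1 (@open_normc_lt _ c s).
rewrite invr_ge0 (ltW e0) => /(_ erefl) H.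
suff : normc (h c) <= e^-1.
  have f0 : 0 < normc (f c - w) by rewrite normc_gt0 fw.
  by rewrite /h normcV lef_pV2 ?posrE // leNgt fc.
apply: H => //.
  move=> z /= zs; apply: (derivableV (fw z zs)).
  by apply: derivableB; [exact/df/ltW|exact: derivable_cst].
move=> M' eM'; have M'0 : 0 < M' by apply: lt_trans eM'; rewrite invr_gt0.
(* Inside the disc these are the points with [|h| >= M']. As [M'^-1 < e], the lower bound on the
   circle keeps [K] inside the open disc. *)
pose K : set R[i]^o := [set z | normc (z - c) <= s /\ normc (f z - w) <= M'^-1].
exists K; split; last first.
- move=> z /= zs /not_andP[|/negP]; first by rewrite (ltW zs).
  rewrite -ltNge => /ltW le1; rewrite /h normcV -[M']invrK lef_pV2 //.
    by rewrite posrE normc_gt0 fw.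
  by rewrite posrE invr_gt0.
- move=> z [zs zf] /=; rewrite lt_neqAle zs andbT; apply/eqP => /fs.
  move=> /le_trans /(_ zf); apply/negP; rewrite -ltNge -[e]invrK ltf_pV2 //.
  by rewrite posrE invr_gt0.
apply: (@closed_bounded_compact _ _ (normc c + s)).
  rewrite -[K]setCK; apply: open_closedC; rewrite openE => z nK.
  have [zs|zs] := leP (normc (z - c)) s; last first.
    have : open (~` [set z : R[i]^o | normc (z - c) <= s]).
      by apply: closed_openC; exact: closed_normc_le.
    rewrite openE => /(_ z); rewrite /= leNgt zs => /(_ notF) h'.
    by rewrite /interior; apply: filterS h' => u nu [].
  have zf : M'^-1 < normc (f z - w).
    by rewrite ltNge; apply/negP => zf; apply: nK.
  have cz := continuous_at_normcB (w := w) (derivable_continuous_at (df z zs)).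
  have h' : nbhs (z : R[i]^o) [set u : R[i]^o | M'^-1 < normc (f u - w)].
    exact: (cz _ (lt_nbhsr zf)).
  by rewrite /interior; apply: filterS h' => u /= uw [_]; rewrite leNgt uw.
move=> z [zs _]; rewrite -[z](subrK c) addrC.
by apply: le_trans (le_normcD _ _) _; rewrite lerD2l.
Qed.

(* The finite part of a conformal map from the complement of [K] onto [|w| > r]
   that fixes infinity, with leading coefficient [d] there. *)
Record exterior_map (R : realType) (K : set R[i]^o) (r : R) (d : R[i])
    (f : R[i]^o -> R[i]^o) : Prop := ExteriorMap {
  ext_closed : closed K ;
  ext_derivable : forall z, ~ K z -> derivable f z 1 ;
  ext_gt : forall z, ~ K z -> r < normc (f z) ;
  ext_inj : forall z w, ~ K z -> ~ K w -> f z = f w -> z = w ;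
  ext_surj : forall w, r < normc w -> exists2 z, ~ K z & f z = w ;
  ext_lead : d != 0 ;
  ext_bounded : exists M C : R, forall z, M < normc z ->
    ~ K z /\ normc (f z - d * z) <= C }.

Lemma closed_complement_disc (R : realType) (K : set R[i]^o) (z : R[i]) :
  closed K -> ~ K z -> exists2 e : R, 0 < e & forall w, normc (w - z) < e -> ~ K w.
Proof. by move=> /closed_openC /open_normcP oK nK; exact: oK. Qed.

(** This is continuity of the inverse. On a small circle around [z0], injectivity and compactness
    keep [f] at distance at least [m > 0] from [f z0]. A value [w] within [m / 2] of [f z0] is then
    at distance at least [m / 2] from the image of the circle, and [value_in_disc] applies. *)
Lemma exterior_map_open (R : realType) (K : set R[i]^o) r d f :
  exterior_map K r d f -> forall (z0 : R[i]) (e : R), ~ K z0 -> 0 < e ->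
  exists2 e' : R, 0 < e' & forall w, normc (w - f z0) < e' ->
    exists2 z, ~ K z /\ normc (z - z0) < e & f z = w.
Proof.
move=> [cK df _ injf _ _ _] z0 e nK e0.
have [e1 e10 e1K] := closed_complement_disc cK nK.
pose s := Num.min e e1 / 2.
have m0 : 0 < Num.min e e1 by rewrite lt_min e0.
have s0 : 0 < s by rewrite divr_gt0.
have sm : s < Num.min e e1 by rewrite ltr_pdivrMr // ltr_pMr // ltr1n.
move: sm; rewrite lt_min => /andP[se se1].
have dK z : normc (z - z0) <= s -> ~ K z by move=> zs; apply: e1K; exact: le_lt_trans se1.
pose S : set R[i]^o := [set z | s <= normc (z - z0) /\ normc (z - z0) <= s].
have [||c /[!inE] -[c1 c2] cmin] := @compact_EVT_min R[i]^o R
  (fun z => normc (f z - f z0)) S _ (@compact_annulus _ z0 s s).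
- exists (z0 + real_complex R s); rewrite /S /= (_ : z0 + _ - z0 = real_complex R s); last by ring.
  by rewrite normc_real ger0_norm ?(ltW s0) // lexx.
- apply: continuous_in_subspaceT => z /[!inE] -[_ zs].
  by apply: continuous_at_normcB; apply: derivable_continuous_at; exact/df/dK.
set m := normc _ in cmin.
have mp : 0 < m.
  rewrite normc_gt0 subr_eq0; apply/eqP => /injf; move=> /(_ (dK _ c2) nK) cz.
  by move: c1; rewrite cz subrr normc0 leNgt s0.
exists (m / 2); first by rewrite divr_gt0.
move=> w wm; have [||||z zs fz] := @value_in_disc R f z0 w s (m / 2) s0.
- by rewrite divr_gt0.
- by move=> z zs; exact/df/dK.
- move=> z zs; have mz : m <= normc (f z - f z0).
    by apply: cmin; rewrite inE /S /= zs lexx.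
  have := ler_normcB (f z - f z0) (w - f z0).
  rewrite (_ : f z - f z0 - (w - f z0) = f z - w); last by ring.
  by move: mz wm; move: (normc _) (normc _) (normc _) => x y u; lra.
- by rewrite normc_distC.
exists z => //; split; first by apply: dK; exact: ltW.
exact: lt_trans se.
Qed.

(** Near infinity [f] is a bounded perturbation of [d * z], so a large value [w] is attained in a
    disc of fixed radius around [w / d]. *)
Lemma exterior_map_near_infinity (R : realType) (K : set R[i]^o) r d f :
  exterior_map K r d f -> forall B : R, exists B' : R, forall w, B' < normc w ->
  exists2 z, ~ K z /\ B < normc z & f z = w.
Proof.
move=> [cK df _ injf _ d0 [M [C0 fC0]]] B.
pose C := `|C0|; have C_ge0 : 0 <= C by exact: normr_ge0.
have fC z : M < normc z -> ~ K z /\ normc (f z - d * z) <= C.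
  by move=> /fC0[nK h]; split => //; apply: le_trans h (ler_norm _).
have nd0 : 0 < normc d by rewrite normc_gt0.
(* On the circle of radius [s] around [w / d] one has [|d * z - w| = 2 * C + 1], hence
   [|f z - w| >= C + 1]; at the centre [|f - w| <= C]. *)
pose s := (2 * C + 1) / normc d.
have s0 : 0 < s by rewrite divr_gt0 // ltr_wpDl // mulr_ge0.
exists ((Num.max M B + s) * normc d) => w wB.
pose c := w / d.
have cB : Num.max M B + s < normc c by rewrite normcM normcV ltr_pdivlMr.
have far z : normc (z - c) <= s -> Num.max M B < normc z.
  move=> zs; have := ler_normcB c z; rewrite [normc (c - z)]normc_distC.
  by move: cB zs; move: (normc _) (normc _) (normc _) (Num.max _ _) => x y u v; lra.
have dz z : d * z - w = d * (z - c) by rewrite mulrBr /c mulrCA divff // mulr1.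
have farM z : normc (z - c) <= s -> M < normc z.
  by move=> /far; rewrite gt_max => /andP[].
have [|||z zs fz] := @value_in_disc R f c w s (C + 1) s0 (ltr_wpDl C_ge0 ltr01).
- by move=> z zs; apply: df; have [] := fC z (farM z zs).
- move=> z zs; have [_ h] := fC z (farM z ltac:(by rewrite zs)).
  have := ler_normcB (d * z - w) (d * z - f z).
  rewrite (_ : d * z - w - (d * z - f z) = f z - w); last by ring.
  rewrite dz normcM zs [normc d * s]mulrC divfK ?gt_eqF // normc_distC.
  by move: h; move: (normc _) (normc _) => x y; lra.
- have [|_ h] := fC c; first by apply: farM; rewrite subrr normc0 ltW.
  rewrite (_ : w = d * c); last by rewrite /c mulrCA divff // mulr1.
  by apply: le_lt_trans h _; rewrite ltrDl.
exists z => //; have := far z (ltW zs); rewrite gt_max => /andP[zM zB].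
by split => //; have [] := fC z zM.
Qed.

(** By injectivity the preimage found near infinity is the only one. Equivalently, [f] is bounded on
    bounded parts of the complement of [K]. *)
Lemma exterior_map_large (R : realType) (K : set R[i]^o) r d f :
  exterior_map K r d f -> forall B : R, exists B' : R, forall z, ~ K z ->
  B' < normc (f z) -> B < normc z.
Proof.
move=> ext B; have [B' h] := exterior_map_near_infinity ext B.
by exists B' => z nK /h[z' [nK' z'B] /(ext_inj ext nK' nK) <-].
Qed.

(** The point is that the set does not accumulate at [K]. Its values lie in a compact annulus inside
    the image. Each such value is attained at some [q] off [K], and nearby values are attained near
    [q]; by injectivity they are not attained near a given point [z] of [K]. *)
Lemma exterior_map_proper (R : realType) (K : set R[i]^o) r d f :
  exterior_map K r d f -> forall (r' B : R), r < r' ->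
  compact ([set z | [/\ ~ K z, r' <= normc (f z) & normc z <= B]] : set R[i]^o).
Proof.
move=> ext r' B rr'; apply: (@closed_bounded_compact _ _ B); last by move=> z [].
set T := [set z | _]; rewrite -[T]setCK; apply: open_closedC; rewrite openE => z nT.
rewrite /interior.
have [zB|zB] := leP (normc z) B; last first.
  have : open (~` [set z : R[i]^o | normc (z - 0) <= B]).
    by apply: closed_openC; exact: closed_normc_le.
  rewrite openE => /(_ z); rewrite /= subr0 leNgt zB => /(_ notF) h.
  by apply: filterS h => u; rewrite /= subr0 => nu [].
have [Kz|nKz] := pselect (K z); last first.
  have fz : normc (f z) < r'.
    by rewrite ltNge; apply/negP => fz; exact: nT.
  have cz := continuous_at_normcB (w := 0) (derivable_continuous_at (ext_derivable ext nKz)).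
  have h : nbhs (z : R[i]^o) [set u : R[i]^o | normc (f u - 0) < r'].
    have fz0 : normc (f z - 0) < r' by rewrite subr0.
    exact: (cz _ (lt_nbhsl fz0)).
  by apply: filterS h => u; rewrite /= subr0 ltNge => /negP fu [].
have [B' large] := exterior_map_large ext B.
(* Compactness of the annulus of values turns the neighbourhoods of [z], one for each value [w],
   into a single one. *)
have /compact_near_coveringP cW := @compact_annulus R 0 r' B'.
have := @cW R[i]^o (nbhs (z : R[i]^o)) (fun u w => ~ (~ K u /\ f u = w)) _.
suff H : (forall w : R[i]^o, [set w : R[i]^o | r' <= normc (w - 0) /\ normc (w - 0) <= B'] w ->
    \forall w' \near w & u \near nbhs (z : R[i]^o), ~ (~ K u /\ f u = w')).
  move=> /(_ (nbhs_filter _) H) h; apply: filterS h => u hu [nKu fur uB].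
  apply: (hu (f u)) => //; split; rewrite subr0 //.
  by rewrite leNgt; apply/negP => /(large _ nKu); rewrite ltNge uB.
move=> w [rw _]; rewrite subr0 in rw.
have [q nKq fq] := ext_surj ext (lt_le_trans rr' rw).
have qz : 0 < normc (q - z).
  by rewrite normc_gt0 subr_eq0; apply/eqP => qz; apply: nKq; rewrite qz.
have [e e0 eP] := exterior_map_open ext nKq (divr_gt0 qz (ltr0n _ 2)).
exists ([set w' | normc (w' - w) < e], [set u | normc (u - z) < normc (q - z) / 2]).
  split; apply/nbhs_normcP; first by exists e.
  by exists (normc (q - z) / 2) => //; rewrite divr_gt0.
move=> [w' u] [/= w'e uz] [nKu fu]; rewrite -fq in w'e.
have [v [nKv vq] fv] := eP _ w'e.
have uv : u = v by apply: (ext_inj ext) => //; rewrite fv.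
have := le_normcD (q - u) (u - z); rewrite (_ : q - u + (u - z) = q - z); last by ring.
move: vq uz; rewrite -uv [normc (q - u)]normc_distC.
by move: (normc _) (normc _) (normc _) => a b c; lra.
Qed.

(** * Limits at infinity *)

(** Stated as a filter, so that the general limit theorems for sums, products and inverses apply. *)
Definition cinfty (R : realType) : set_system R[i]^o :=
  [set A | exists M : R, forall z, M < normc z -> A z].

Lemma exists_normc_gt (R : realType) (M : R) : exists z : R[i], M < normc z.
Proof.
exists (real_complex R (`|M| + 1)); rewrite normc_real ger0_norm.
  by rewrite (le_lt_trans (ler_norm _)) // ltrDl.
by rewrite addr_ge0.
Qed.

#[export] Instance cinfty_filter (R : realType) : ProperFilter (@cinfty R).
Proof.
apply: Build_ProperFilter_ex.
  by move=> A [M hM]; have [z zM] := exists_normc_gt M; exists z; exact: hM.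
split; first by exists 0.
  move=> A B [M hM] [N hN]; exists (Num.max M N) => z; rewrite gt_max => /andP[zM zN].
  by split; [exact: hM|exact: hN].
by move=> A B AB [M hM]; exists M => z /hM /AB.
Qed.

Definition limit_oo (R : realType) (f : R[i]^o -> R[i]^o) (l : R[i]) : Prop :=
  f @ @cinfty R --> (l : R[i]^o).

Lemma limit_ooP (R : realType) (f : R[i]^o -> R[i]^o) (l : R[i]) :
  limit_oo f l <-> forall e : R, 0 < e -> exists M : R,
    forall z, M < normc z -> normc (f z - l) < e.
Proof.
split=> [fl e e0|fl A /nbhs_normcP[e e0 eA]].
  have : nbhs (l : R[i]^o) [set w : R[i]^o | normc (w - l) < e].
    by apply/nbhs_normcP; exists e.
  by move=> /fl.
by have [M hM] := fl e e0; exists M => z /hM /eA.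
Qed.

Lemma limit_oo_eq (R : realType) (f g : R[i]^o -> R[i]^o) (l : R[i]) (M : R) :
  (forall z, M < normc z -> f z = g z) -> limit_oo f l -> limit_oo g l.
Proof.
move=> fg /limit_ooP fl; apply/limit_ooP => e /fl[N hN].
exists (Num.max M N) => z; rewrite gt_max => /andP[zM zN].
by rewrite -fg // hN.
Qed.

Lemma limit_oo_unique (R : realType) (f : R[i]^o -> R[i]^o) (l l' : R[i]) :
  limit_oo f l -> limit_oo f l' -> l = l'.
Proof. by move=> fl fl'; exact: (cvg_unique (@normc_hausdorff R) fl fl'). Qed.

Lemma limit_oo_cst (R : realType) (l : R[i]) : limit_oo (fun=> l) l.
Proof. exact: cvg_cst. Qed.

Lemma limit_ooD (R : realType) (f g : R[i]^o -> R[i]^o) (k l : R[i]) :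
  limit_oo f k -> limit_oo g l -> limit_oo (fun z => f z + g z) (k + l).
Proof. exact: cvgD. Qed.

Lemma limit_ooM (R : realType) (f g : R[i]^o -> R[i]^o) (k l : R[i]) :
  limit_oo f k -> limit_oo g l -> limit_oo (fun z => f z * g z) (k * l).
Proof. exact: cvgM. Qed.

Lemma limit_ooV (R : realType) (f : R[i]^o -> R[i]^o) (l : R[i]) :
  l != 0 -> limit_oo f l -> limit_oo (fun z => (f z)^-1) l^-1.
Proof. by move=> l0; exact: cvgV. Qed.

Lemma limit_ooX (R : realType) (f : R[i]^o -> R[i]^o) (l : R[i]) n :
  limit_oo f l -> limit_oo (fun z => f z ^+ n) (l ^+ n).
Proof.
move=> fl; elim: n => [|n IH]; first by rewrite expr0; exact: limit_oo_cst.
rewrite exprS; apply: (@limit_oo_eq _ (fun z => f z * f z ^+ n) _ _ 0).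
  by move=> z _; rewrite exprS.
exact: limit_ooM.
Qed.

Lemma limit_oo_sum (R : realType) n (f : 'I_n -> R[i]^o -> R[i]^o) (l : 'I_n -> R[i]) :
  (forall j, limit_oo (f j) (l j)) ->
  limit_oo (fun z => \sum_(j < n) f j z) (\sum_(j < n) l j).
Proof.
elim: n f l => [|n IH] f l fl.
  rewrite big_ord0; apply: (@limit_oo_eq _ (fun=> 0) _ _ 0).
    by move=> z _; rewrite big_ord0.
  exact: limit_oo_cst.
rewrite big_ord_recl.
apply: (@limit_oo_eq _ (fun z => f ord0 z + \sum_(j < n) f (lift ord0 j) z) _ _ 0).
  by move=> z _; rewrite big_ord_recl.
by apply: limit_ooD => //; apply: IH => j; exact: fl.
Qed.

Lemma limit_oo_inv (R : realType) : limit_oo (fun z : R[i]^o => z^-1) 0.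
Proof.
apply/limit_ooP => e e0; exists e^-1 => z ez.
rewrite subr0 normcV -[e]invrK ltf_pV2 ?posrE ?invr_gt0 //.
by apply: lt_trans ez; rewrite invr_gt0.
Qed.

Lemma limit_oo_bounded_div (R : realType) (f : R[i]^o -> R[i]^o) (M C : R) :
  (forall z, M < normc z -> normc (f z) <= C) -> limit_oo (fun z => f z / z) 0.
Proof.
move=> fC; apply/limit_ooP => e e0; exists (Num.max M ((`|C| + 1) / e)) => z.
rewrite gt_max => /andP[/fC fz]; rewrite subr0 normcM normcV.
rewrite ltr_pdivrMr // => zC.
have z0 : 0 < normc z.
  rewrite -(pmulr_lgt0 _ e0); apply: le_lt_trans zC.
  by rewrite addr_ge0.
rewrite ltr_pdivrMr // mulrC (le_lt_trans fz) // (le_lt_trans (ler_norm C)) //.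
by apply: lt_trans zC; rewrite ltrDl.
Qed.

Lemma limit_oo_neq0 (R : realType) (f : R[i]^o -> R[i]^o) (l : R[i]) :
  limit_oo f l -> l != 0 -> exists M : R, forall z, M < normc z -> f z != 0.
Proof.
move=> /limit_ooP fl l0; have [|M hM] := fl (normc l); first by rewrite normc_gt0.
exists M => z /hM; apply: contraTneq => ->.
by rewrite sub0r normcN ltxx.
Qed.

(** Degrees below [n] are allowed, so the second coefficient can be read off as well, once the
    leading term has been subtracted. *)
Lemma limit_oo_poly (R : realType) (P : {poly R[i]}) n : (size P <= n.+1)%N ->
  limit_oo (fun z : R[i]^o => P.[z] / z ^+ n) P`_n.
Proof.
elim/poly_ind: P n => [|p c IH] n sz.
  rewrite coef0; apply: (@limit_oo_eq _ (fun=> 0) _ _ 0); last exact: limit_oo_cst.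
  by move=> z _; rewrite horner0 mul0r.
rewrite coefD coefMX coefC; case: n sz => [|n] sz /=.
  have p0 : p = 0.
    apply/eqP; rewrite -size_poly_eq0; move: sz; rewrite size_MXaddC.
    by case: ifP => [/andP[/eqP -> _]|_]; rewrite ?size_poly0 // ltnS leqn0.
  rewrite p0 add0r; apply: (@limit_oo_eq _ (fun=> c) _ _ 0); last exact: limit_oo_cst.
  by move=> z _; rewrite mul0r add0r hornerC expr0 divr1.
rewrite addr0.
have szp : (size p <= n.+1)%N.
  move: sz; rewrite size_MXaddC; case: ifP => [/andP[/eqP -> _]|_] //.
  by rewrite size_poly0.
apply: (@limit_oo_eq _ (fun z => p.[z] / z ^+ n + c * z^-1 ^+ n.+1) _ _ 0).
  move=> z; rewrite normc_gt0 => z0; rewrite hornerD hornerM hornerX hornerC.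
  by rewrite exprVn exprSr; field; rewrite z0 expf_neq0.
rewrite -[X in limit_oo _ X]addr0; apply: limit_ooD; first exact: IH.
rewrite -(mulr0 c); apply: limit_ooM; first exact: limit_oo_cst.
by have := limit_ooX (n := n.+1) (@limit_oo_inv R); rewrite expr0n.
Qed.

(** * Functions with vanishing derivative or constant modulus *)

Lemma zero_derivative_segment (R : realType) (u : R -> R) :
  (forall x : R, 0 <= x <= 1 -> forall e : R, 0 < e -> exists2 d : R, 0 < d &
    forall h, `|h| < d -> `|u (x + h) - u x| <= e * `|h|) -> u 0 = u 1.
Proof.
move=> du.
have cu (x : R) : 0 <= x <= 1 -> {for x, continuous u}.
  move=> /du /(_ 1 ltr01)[d d0 dP]; apply/cvgrPdist_lt => e e0.
  apply/nbhs_ballP; exists (Num.min d e); first by rewrite /= lt_min d0.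
  move=> y; rewrite /ball /= lt_min distrC => /andP[yd ye].
  have := dP (y - x) yd; rewrite mul1r (_ : x + (y - x) = y); last by ring.
  by rewrite distrC => /le_lt_trans; exact.
have diffu (x : R) : x \in `]0, 1[ -> is_derive x 1 u ((fun=> 0) x).
  rewrite in_itv /= => /andP[x0 x1].
  have lim : (fun h : R => h^-1 *: ((u \o shift x) (h *: 1) - u x)) @ 0^' --> (0 : R).
    apply/cvgr0Pnorm_le => e e0.
    have [|d d0 dP] := du x _ e e0; first by rewrite !ltW.
    apply/nbhs_ballP; exists d => // h; rewrite /ball /= sub0r normrN => hd h0.
    rewrite /= [h *: 1]mulr1 (addrC h) normrZ normfV.
    by rewrite ler_pdivrMl ?normr_gt0 // mulrC dP.
  apply: DeriveDef; first by apply/cvg_ex; exists 0.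
  exact: cvg_lim lim.
have [|c _] := MVT_segment ler01 diffu; last first.
  by rewrite mul0r => /eqP; rewrite subr_eq0 => /eqP.
by apply: continuous_in_subspaceT => x; rewrite inE /= in_itv /=; exact: cu.
Qed.

(** The mean value theorem fails for complex values; it is applied to the real and the imaginary
    part along the segment. *)
Lemma zero_cderivative_segment (R : realType) (t : R[i] -> R[i]) (z w : R[i]) :
  (forall x : R, 0 <= x <= 1 -> forall e : R, 0 < e -> exists2 d : R, 0 < d &
    forall h, normc h < d ->
    normc (t (z + real_complex R x * (w - z) + h) - t (z + real_complex R x * (w - z))) <=
    e * normc h) -> t z = t w.
Proof.
move=> dt.
have key (phi : R[i] -> R) : (forall a b, phi (a - b) = phi a - phi b) ->
    (forall a, `|phi a| <= normc a) -> phi (t z) = phi (t w).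
  move=> phiB phile.
  pose u (x : R) := phi (t (z + real_complex R x * (w - z))).
  suff : u 0 = u 1.
    by rewrite /u rmorph0 rmorph1 mul0r mul1r addr0 (_ : z + (w - z) = w); last by ring.
  apply: zero_derivative_segment => x x01 e e0.
  (* The [+ 1] keeps [N] positive when [w = z]. *)
  pose N := normc (w - z) + 1.
  have N0 : 0 < N by rewrite ltr_wpDl ?normc_ge0.
  have [d d0 dP] := dt x x01 (e / N) (divr_gt0 e0 N0).
  exists (d / N) => [|h]; first by rewrite divr_gt0.
  rewrite ltr_pdivlMr // => hd.
  have le1 : normc (real_complex R h * (w - z)) <= `|h| * N.
    by rewrite normcM normc_real ler_wpM2l // /N lerDl.
  rewrite /u -phiB (le_trans (phile _)) //.
  rewrite rmorphD /= mulrDl addrA (le_trans (dP _ (le_lt_trans le1 hd))) //.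
  apply: le_trans (ler_wpM2l _ le1) _; first by rewrite divr_ge0 ?ltW.
  by rewrite mulrCA mulrC divfK ?gt_eqF // mulrC.
apply/eqP; rewrite eq_complex; apply/andP; split; apply/eqP; apply: key.
- by move=> a b; rewrite cReD cReN.
- exact: le_Re_normc.
- by move=> a b; rewrite cImD cImN.
- exact: le_Im_normc.
Qed.

(** If the derivative [l] were nonzero, choose [h] with [l * h = s * t z] and [s > 0]: the linear
    part then has modulus [(1 + s) * q], while the error is at most [s * q / 2], so
    [|t (z + h)| > q]. *)
Lemma constant_normc_derivative (R : realType) (t : R[i]^o -> R[i]^o) (z : R[i]) (q r : R) :
  0 < r -> 0 < q -> (forall w, normc (w - z) < r -> normc (t w) = q) ->
  derivable t z 1 -> forall e : R, 0 < e -> exists2 d : R, 0 < d &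
    forall h, normc h < d -> normc (t (z + h) - t z) <= e * normc h.
Proof.
move=> r0 q0 tq /derivable_normcP[l tl].
suff l0 : l = 0.
  move=> e /tl[d d0 dP]; exists d => // h /dP.
  by rewrite l0 mul0r subr0.
apply: contrapT => /eqP l0.
have nl : 0 < normc l by rewrite normc_gt0.
have [d d0 dP] := tl (normc l / 2) (divr_gt0 nl (ltr0n _ 2)).
have tz : normc (t z) = q by apply: tq; rewrite subrr normc0.
(* Chosen so that [|h| = s * q / |l|] is half of [Num.min d r]. *)
pose s := Num.min d r * normc l / (2 * q).
have s0 : 0 < s by rewrite !(divr_gt0, mulr_gt0) // lt_min d0.
pose h := real_complex R s * t z / l.
have nh : normc h = s * q / normc l.
  by rewrite /h !normcM normcV normc_real tz ger0_norm // ltW.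
have hm : normc h < Num.min d r.
  rewrite nh /s (_ : _ / normc l = Num.min d r / 2); last first.
    by field; rewrite !gt_eqF.
  by rewrite ltr_pdivrMr // ltr_pMr ?ltr1n // lt_min d0.
move: hm; rewrite lt_min => /andP[hd hr].
have := dP h hd; have tzh : normc (t (z + h)) = q.
  by apply: tq; rewrite (_ : z + h - z = h) //; ring.
have lh : l * h = real_complex R s * t z by rewrite /h mulrC divfK.
have := ler_normcB (t z + l * h) (t (z + h)).
rewrite (_ : t z + l * h - t (z + h) = - (t (z + h) - t z - l * h)); last by ring.
rewrite normcN tzh lh (_ : t z + _ = real_complex R (1 + s) * t z); last first.
  by rewrite rmorphD rmorph1 /= mulrDl mul1r.
rewrite normcM normc_real tz ger0_norm; last by rewrite addr_ge0 // ltW.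
rewrite nh => h1 h2; have := le_trans h1 h2.
rewrite (_ : normc l / 2 * _ = s * q / 2); last by field; rewrite gt_eqF.
have : 0 < s * q by rewrite mulr_gt0.
by rewrite mulrDl mul1r; lra.
Qed.

(* [t] is locally constant, and equal to [c] near infinity. The maximum principle
   for [f] on the bounded open set where [t <> c] shows that this set is empty. *)
Lemma exterior_constant_normc (R : realType) (K : set R[i]^o) r d f
    (t : R[i]^o -> R[i]^o) (q : R) (c : R[i]) :
  exterior_map K r d f -> 0 <= r -> 0 < q ->
  (forall z, ~ K z -> derivable t z 1) -> (forall z, ~ K z -> normc (t z) = q) ->
  limit_oo t c -> forall z, ~ K z -> t z = c.
Proof.
move=> ext r0 q0 dt tq tc.
have cK := ext_closed ext.
have flat z : ~ K z -> forall e : R, 0 < e -> exists2 d : R, 0 < d &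
    forall h, normc h < d -> normc (t (z + h) - t z) <= e * normc h.
  move=> nK; have [e e0 eK] := closed_complement_disc cK nK.
  by apply: (constant_normc_derivative e0 q0); [move=> w /eK; exact: tq|exact: dt].
have loc z : ~ K z -> exists2 e : R, 0 < e & forall w, normc (w - z) < e -> t z = t w.
  move=> nK; have [e e0 eK] := closed_complement_disc cK nK; exists e => // w wz.
  apply: zero_cderivative_segment => x /andP[x0 x1]; apply/flat/eK.
  rewrite (_ : z + _ - z = real_complex R x * (w - z)); last by ring.
  rewrite normcM normc_real ger0_norm //; apply: le_lt_trans wz.
  by rewrite ler_piMl ?normc_ge0.
have [M0 [C0 extM]] := ext_bounded ext.
pose M := Num.max M0 0.
have KM z : M < normc z -> ~ K z by rewrite gt_max => /andP[/extM[]].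
have far z : M < normc z -> t z = c.
  move=> zM; apply: (@limit_oo_unique _ (fun=> t z)); first exact: limit_oo_cst.
  apply/limit_ooP => e e0; have /limit_ooP/(_ e e0)[N hN] := tc.
  have z0 : 0 < normc z by move: zM; rewrite gt_max => /andP[].
  exists 0 => _ _.
  (* The ray from [z] away from 0 avoids [K], so [t] is constant on it. The point [k * z] has
     modulus [|z| + |N| > N], where [t] is within [e] of [c]. *)
  pose k := 1 + `|N| / normc z.
  have k1 : 0 <= `|N| / normc z by rewrite divr_ge0 // ltW.
  rewrite (@zero_cderivative_segment _ t z (real_complex R k * z)).
    apply: hN; rewrite normcM normc_real ger0_norm; last by rewrite /k addr_ge0.
    rewrite /k mulrDl mul1r divfK ?gt_eqF //.
    by rewrite (le_lt_trans (ler_norm N)) // ltrDr.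
  move=> x /andP[x0 x1]; apply/flat/KM.
  rewrite (_ : z + _ = real_complex R (1 + x * (`|N| / normc z)) * z); last first.
    by rewrite /k !rmorphD !rmorphM !rmorph1 /=; ring.
  rewrite normcM normc_real ger0_norm; last by rewrite addr_ge0 // mulr_ge0.
  by apply: lt_le_trans zM _; rewrite ler_peMl ?(ltW z0) // lerDl mulr_ge0.
move=> z1 nK1; apply: contrapT => tz1.
pose A : set R[i]^o := [set z | ~ K z /\ t z <> c].
have locA z (nK : ~ K z) : (t z = c -> exists2 e : R, 0 < e & forall w, normc (w - z) < e -> t w = c).
  by move=> <-; have [e e0 he] := loc z nK; exists e => // w /he ->.
have oA : open A.
  apply/open_normcP => z [nK tz].
  have [e e0 he] := loc z nK; have [e' e'0 he'] := closed_complement_disc cK nK.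
  exists (Num.min e e'); first by rewrite lt_min e0.
  by move=> w; rewrite lt_min => /andP[/he tw /he' nKw]; split => //; rewrite -tw.
have := @max_modulus R A f r oA r0 _ _ z1 (conj nK1 tz1).
suff H : forall M', r < M' -> exists K' : set R[i]^o, [/\ compact K', K' `<=` A &
     forall z, A z -> ~ K' z -> normc (f z) <= M'].
  move=> /(_ (fun z Az => ext_derivable ext (proj1 Az)) H).
  by rewrite leNgt (ext_gt ext nK1).
move=> M' rM'.
have cS := exterior_map_proper (B := M) ext rM'.
set S := [set z | _] in cS.
(* Compact because [A] is also closed relative to the complement of [K]: where [t] equals [c], it
   does so on a neighbourhood. *)
exists (S `&` A); split; last first.
- move=> z Az nSA; rewrite leNgt; apply/negP => zM'; apply: nSA; split => //.
  have [nKz tz] := Az; split=> //; first exact: ltW.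
  by rewrite leNgt; apply/negP => /far.
- by move=> z [].
apply: (subclosed_compact _ cS) => [|z []//].
rewrite -[X in closed X]setCK; apply: open_closedC; apply/open_normcP => z nSA.
have [Sz|nSz] := pselect (S z).
  have nK : ~ K z by case: Sz.
  have tz : t z = c by apply: contrapT => tz; apply: nSA.
  have [e e0 he] := locA z nK tz.
  by exists e => // w /he tw [_ [_]].
have /open_normcP/(_ z nSz)[e e0 he] : open (~` S).
  by apply: closed_openC; exact: compact_closed (@normc_hausdorff R) cS.
by exists e => // w /he nSw [].
Qed.

(** * Comparison of exterior maps *)

Lemma derivable_chorner (R : realType) (P : {poly R[i]}) (z : R[i]^o) :
  derivable (fun w : R[i]^o => P.[w] : R[i]^o) z 1.
Proof.
elim/poly_ind: P => [|p c IH].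
  rewrite (_ : (fun w => _) = fun=> 0); first exact: derivable_cst.
  by apply/funext => w; rewrite horner0.
rewrite (_ : (fun w => _) = fun w : R[i]^o => p.[w] * w + c : R[i]^o).
  apply: derivableD; last exact: derivable_cst.
  by apply: derivableM; [exact: IH|exact: derivable_id].
by apply/funext => w; rewrite hornerD hornerM hornerX hornerC.
Qed.

Lemma derivable_fun_mul (R : realType) (f g : R[i]^o -> R[i]^o) (z : R[i]^o) :
  derivable f z 1 -> derivable g z 1 ->
  derivable (fun w : R[i]^o => f w * g w : R[i]^o) z 1.
Proof. exact: derivableM. Qed.

Lemma derivable_fun_inv (R : realType) (f : R[i]^o -> R[i]^o) (z : R[i]^o) :
  f z != 0 -> derivable f z 1 ->
  derivable (fun w : R[i]^o => (f w)^-1 : R[i]^o) z 1.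
Proof. exact: derivableV. Qed.

Lemma derivable_fun_exp (R : realType) (f : R[i]^o -> R[i]^o) (z : R[i]^o) n :
  derivable f z 1 -> derivable (fun w : R[i]^o => f w ^+ n : R[i]^o) z 1.
Proof.
move=> df; elim: n => [|n IH].
  rewrite (_ : (fun w => _) = fun=> 1); first exact: derivable_cst.
  by apply/funext => w; rewrite expr0.
rewrite (_ : (fun w => _) = fun w : R[i]^o => f w * f w ^+ n : R[i]^o).
  exact: derivable_fun_mul.
by apply/funext => w; rewrite exprS.
Qed.

Lemma limit_oo_invX (R : realType) n : (0 < n)%N ->
  limit_oo (fun z : R[i]^o => (z ^+ n)^-1) 0.
Proof.
case: n => // n _; have := limit_ooX (n := n.+1) (@limit_oo_inv R).
rewrite expr0n /=; apply: (@limit_oo_eq _ _ _ _ 0) => z _.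
by rewrite exprVn.
Qed.

(** Zeros of [f] have to be excluded, since [0^-1] is 0. *)
Lemma limit_oo_small_large (R : realType) (f : R[i]^o -> R[i]^o) (M0 : R) :
  (forall z, M0 < normc z -> f z != 0) -> limit_oo (fun z => (f z)^-1) 0 ->
  forall B : R, exists M : R, forall z, M < normc z -> B < normc (f z).
Proof.
move=> f0 /limit_ooP fl B.
have B0 : 0 < `|B| + 1 by rewrite ltr_wpDl.
have [|M hM] := fl (`|B| + 1)^-1; first by rewrite invr_gt0.
exists (Num.max M0 M) => z; rewrite gt_max => /andP[/f0 fz /hM].
rewrite subr0 normcV ltf_pV2 ?posrE ?normc_gt0 // => /(le_lt_trans _); apply.
by rewrite (le_trans (ler_norm _)) // lerDl.
Qed.

Lemma poly_lead_neq0 (R : realType) (P : {poly R[i]}) n :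
  size P = n.+1 -> P`_n != 0.
Proof.
move=> sz; have := lead_coef_eq0 P; rewrite lead_coefE sz /= => ->.
by rewrite -size_poly_eq0 sz.
Qed.

Lemma poly_large (R : realType) (P : {poly R[i]}) n : size P = n.+1 -> (0 < n)%N ->
  forall B : R, exists M : R, forall z, M < normc z -> B < normc P.[z].
Proof.
move=> sz n0; have p0 := poly_lead_neq0 sz.
have /limit_oo_poly lP : (size P <= n.+1)%N by rewrite sz.
have [M0 hM0] := limit_oo_neq0 lP p0.
apply: (@limit_oo_small_large _ (fun z => P.[z]) M0).
  by move=> z /hM0; apply: contraNneq => ->; rewrite mul0r.
have := limit_ooM (limit_ooV p0 lP) (@limit_oo_invX R n n0).
rewrite mulr0; apply: (@limit_oo_eq _ _ _ _ 0) => z.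
by rewrite normc_gt0 => z0; rewrite invfM invrK mulfK // expf_neq0.
Qed.

Lemma exterior_map_limit (R : realType) (K : set R[i]^o) r d f :
  exterior_map K r d f -> limit_oo (fun z => f z / z) d.
Proof.
move=> ext; have [M [C h]] := ext_bounded ext.
have l0 : limit_oo (fun z => (f z - d * z) / z) 0.
  by apply: (@limit_oo_bounded_div _ (fun z => f z - d * z) M C) => z /h[].
have := limit_ooD l0 (@limit_oo_cst R d); rewrite add0r.
apply: (@limit_oo_eq _ _ _ _ 0) => z; rewrite normc_gt0 => z0.
by rewrite mulrBl mulfK // subrK.
Qed.

Lemma exterior_map_limitX (R : realType) (K : set R[i]^o) r f n :
  exterior_map K r 1 f -> limit_oo (fun z => f z ^+ n / z ^+ n) 1.
Proof.
move=> /exterior_map_limit l; have := limit_ooX (n := n) l; rewrite expr1n.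
by apply: (@limit_oo_eq _ _ _ _ 0) => z _; rewrite expr_div_n.
Qed.

(** The difference [f w - d * w] is bounded near infinity, so any positive power of [z] in the
    denominator suffices. The choice [m = n] serves for the leading coefficient, and [m = n - 1],
    positive when [n >= 2], for the next one. *)
Lemma exterior_map_poly_error (R : realType) (K : set R[i]^o) r d f
    (P : {poly R[i]}) n m : exterior_map K r d f -> size P = n.+1 -> (0 < n)%N ->
  (0 < m)%N -> limit_oo (fun z => (f P.[z] - d * P.[z]) / z ^+ m) 0.
Proof.
move=> ext sz n0; case: m => // m _; have [M [C h]] := ext_bounded ext.
have [N hN] := poly_large sz n0 M.
have l0 : limit_oo (fun z => (f P.[z] - d * P.[z]) / z) 0.
  by apply: (@limit_oo_bounded_div _ (fun z => f P.[z] - d * P.[z]) N C) => z /hN /h[].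
have := limit_ooM l0 (limit_ooX (n := m) (@limit_oo_inv R)); rewrite mul0r.
apply: (@limit_oo_eq _ _ _ _ 0) => z; rewrite normc_gt0 => z0.
by rewrite exprVn exprS invfM mulrA.
Qed.

Lemma exterior_map_poly_limit (R : realType) (K : set R[i]^o) r d f
    (P : {poly R[i]}) n : exterior_map K r d f -> size P = n.+1 -> (0 < n)%N ->
  limit_oo (fun z => f P.[z] / z ^+ n) (d * P`_n).
Proof.
move=> ext sz n0; have /limit_oo_poly lP : (size P <= n.+1)%N by rewrite sz.
have := limit_ooD (exterior_map_poly_error ext sz n0 n0)
  (limit_ooM (@limit_oo_cst R d) lP).
rewrite add0r; apply: (@limit_oo_eq _ _ _ _ 0) => z _.
by rewrite mulrA -mulrDl subrK.
Qed.

(** The [k]-th root of the fixed factor [T] disappears as [k] grows. *)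
Lemma le_of_expr_le (R : realType) (x y T : R) : 0 <= x -> 0 <= y -> 0 <= T ->
  (forall k, x ^+ k <= y ^+ k * T) -> x <= y.
Proof.
move=> x0 y0 T0 le; rewrite leNgt; apply/negP => yx.
have x_gt0 : 0 < x by exact: le_lt_trans yx.
have T1 : 0 < T + 1 by rewrite ltr_wpDl.
have [|||k hk] := @exists_expr_lt R (y / x) (T + 1)^-1.
- by rewrite divr_ge0.
- by rewrite ltr_pdivrMr // mul1r.
- by rewrite invr_gt0.
move: hk; rewrite expr_div_n ltr_pdivrMr ?exprn_gt0 // ltr_pdivlMl // mulrDl mul1r.
have := le k; have := exprn_ge0 k y0; rewrite [_ * T]mulrC.
by lra.
Qed.

(** Turns a level above [r ^+ m] for a power into a level above [r] for its base, as properness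
    requires. *)
Lemma exists_expr_le (R : realType) (r M : R) m : r ^+ m < M ->
  exists2 r', r < r' & r' ^+ m <= M.
Proof.
move=> rM; have /nbhs_ballP[e /= e0 he] : nbhs r [set x : R | x ^+ m < M].
  exact: (@exprn_continuous _ m r _ (lt_nbhsl rM)).
exists (r + e / 2); first by rewrite ltrDl divr_gt0.
apply/ltW/he; rewrite /ball /= opprD addrA subrr sub0r normrN ger0_norm.
  by rewrite ltr_pdivrMr // ltr_pMr // ltr1n.
by rewrite divr_ge0 // ltW.
Qed.

(* The maximum principle is applied to [psi ^ (n k) / rho ^ (k + 1)] and to
   [rho ^ k / psi ^ (n (k + 1))]: the extra factor makes them vanish at infinity,
   and it is negligible when [k] is large. *)
Lemma exterior_map_comparison (R : realType) (K : set R[i]^o) (r : R)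
    (psi rho : R[i]^o -> R[i]^o) n (c : R[i]) : (0 < n)%N ->
  exterior_map K r 1 psi -> 0 <= r ->
  (forall z, ~ K z -> derivable rho z 1) ->
  (forall z, ~ K z -> 1 < normc (rho z)) ->
  (forall (t B : R), 1 < t -> compact
    ([set z | [/\ ~ K z, t <= normc (rho z) & normc z <= B]] : set R[i]^o)) ->
  c != 0 -> limit_oo (fun z => rho z / z ^+ n) c ->
  forall z, ~ K z -> normc (psi z) ^+ n = r ^+ n * normc (rho z).
Proof.
move=> n0 ext r0 drho rho1 prho c0 lrho.
have oK : open (~` K) by apply: closed_openC; exact: ext_closed ext.
have psi_gt0 z : ~ K z -> 0 < normc (psi z).
  by move=> /(ext_gt ext); exact: le_lt_trans.
have psi0 z : ~ K z -> psi z != 0 by move=> /psi_gt0; rewrite normc_gt0.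
have rho_gt0 z : ~ K z -> 0 < normc (rho z).
  by move=> /rho1; exact: lt_trans.
have rho0 z : ~ K z -> rho z != 0 by move=> /rho_gt0; rewrite normc_gt0.
have lpsi := @exterior_map_limitX _ _ _ _ n ext.
have lV : limit_oo (fun z => (rho z)^-1) 0.
  have := limit_ooM (limit_ooV c0 lrho) (@limit_oo_invX R n n0); rewrite mulr0.
  apply: (@limit_oo_eq _ _ _ _ 0) => z; rewrite normc_gt0 => z0.
  by rewrite invfM invrK mulfK // expf_neq0.
have lpV : limit_oo (fun z => (psi z ^+ n)^-1) 0.
  have := limit_ooM (limit_ooV (oner_neq0 _) lpsi) (@limit_oo_invX R n n0); rewrite mulr0.
  apply: (@limit_oo_eq _ _ _ _ 0) => z; rewrite normc_gt0 => z0.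
  by rewrite invfM invrK mulfK // expf_neq0.
have small (f : R[i]^o -> R[i]^o) (M : R) : limit_oo f 0 -> 0 < M ->
    exists B : R, forall z, B < normc z -> normc (f z) <= M.
  move=> /limit_ooP fl /fl[B hB]; exists B => z /hB.
  by rewrite subr0 => /ltW.
have upper z : ~ K z -> normc (psi z) ^+ n <= r ^+ n * normc (rho z).
  (* The maximum principle will give [|psi| ^ (n k) <= r ^ (n k) * |rho| ^ (k + 1)]; the surplus
     factor [|rho z|] does not depend on [k]. *)
  move=> nKz; apply: (@le_of_expr_le _ _ _ (normc (rho z))).
  - by rewrite exprn_ge0 // normc_ge0.
  - by rewrite mulr_ge0 ?exprn_ge0 ?normc_ge0.
  - exact: normc_ge0.
  move=> k; pose h (w : R[i]^o) : R[i]^o := (psi w ^+ n) ^+ k * (rho w)^-1 ^+ k.+1.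
  have hE w : normc (h w) = normc (psi w) ^+ (n * k) / normc (rho w) ^+ k.+1.
    by rewrite /h normcM !normcX normcV exprVn -exprM.
  have lh : limit_oo h 0.
    have := limit_ooM (limit_ooX (n := k) (limit_ooM lpsi (limit_ooV c0 lrho))) lV.
    rewrite mulr0; apply: (@limit_oo_eq _ _ _ _ 0) => w; rewrite normc_gt0 => w0.
    by rewrite /h invfM invrK mulrACA mulVf ?expf_neq0 // mulr1 exprSr exprMn mulrA.
  have hz : normc (h z) <= r ^+ (n * k).
    have dh w : ~ K w -> derivable h w 1.
      move=> nKw; apply: (@derivable_fun_mul _ (fun w => (psi w ^+ n) ^+ k)).
        apply: (@derivable_fun_exp _ (fun w => psi w ^+ n)).
        exact: (derivable_fun_exp (f := psi) (ext_derivable ext nKw)).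
      apply: (@derivable_fun_exp _ (fun w => (rho w)^-1)).
      exact: (derivable_fun_inv (f := rho) (rho0 _ nKw) (drho _ nKw)).
    apply: (@max_modulus R (~` K) h (r ^+ (n * k)) oK (exprn_ge0 _ r0) dh _ z nKz).
    move=> M' rM'; have [r' rr' r'M'] := exists_expr_le rM'.
    have M'0 : 0 < M' by apply: le_lt_trans rM'; rewrite exprn_ge0.
    have [B hB] := small h M' lh M'0.
    exists [set z | [/\ ~ K z, r' <= normc (psi z) & normc z <= B]]; split.
    - exact: (exterior_map_proper (B := B) ext rr').
    - by move=> w [].
    (* Off the compact set, either [w] is so large that [h] is small, or [|psi w| < r']; in the
       latter case [|rho w| > 1] gives [|h w| <= r' ^ (n k) <= M']. *)
    move=> w nKw nS; have [wB|wB] := ltP B (normc w); first exact: hB.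
    have wr' : normc (psi w) < r'.
      by rewrite ltNge; apply/negP => wr'; apply: nS.
    rewrite hE ler_pdivrMr ?exprn_gt0 ?rho_gt0 //.
    apply: le_trans (_ : M' * 1 <= _); last first.
      by rewrite ler_pM2l // exprn_ege1 // ltW // rho1.
    rewrite mulr1; apply: le_trans r'M'; apply: lerXn2r; rewrite ?nnegrE ?normc_ge0 //.
      by rewrite (le_trans r0) // ltW.
    exact: ltW.
  move: hz; rewrite hE ler_pdivrMr ?exprn_gt0 ?rho_gt0 // !exprM => /le_trans; apply.
  by rewrite exprMn exprSr mulrA.
have lower z : ~ K z -> r ^+ n * normc (rho z) <= normc (psi z) ^+ n.
  (* With [r = 0] the inequality [upper] would force [psi z = 0], against [|psi z| > r]. *)
  move=> nKz; have r_gt0 : 0 < r.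
    rewrite lt_neqAle r0 andbT; apply/eqP => rE; have := upper z nKz.
    by rewrite -rE expr0n gtn_eqF // mul0r leNgt exprn_gt0 // psi_gt0.
  rewrite -ler_pdivlMl ?exprn_gt0 //.
  have rn : 0 < r ^+ n by rewrite exprn_gt0.
  apply: (@le_of_expr_le _ _ _ ((r ^+ n)^-1 * normc (psi z) ^+ n)).
  - exact: normc_ge0.
  - by rewrite mulr_ge0 ?invr_ge0 ?exprn_ge0 ?normc_ge0.
  - by rewrite mulr_ge0 ?invr_ge0 ?exprn_ge0 ?normc_ge0.
  move=> k; rewrite -exprSr exprMn exprVn -exprM -ler_pdivrMr; last first.
    by rewrite exprn_gt0 // exprn_gt0 // psi_gt0.
  pose h (w : R[i]^o) : R[i]^o := rho w ^+ k * (psi w ^+ n)^-1 ^+ k.+1.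
  have hE w : normc (h w) = normc (rho w) ^+ k / (normc (psi w) ^+ n) ^+ k.+1.
    by rewrite /h normcM !normcX normcV normcX exprVn.
  have lh : limit_oo h 0.
    have := limit_ooM (limit_ooX (n := k) (limit_ooM lrho (limit_ooV (oner_neq0 _) lpsi))) lpV.
    rewrite mulr0; apply: (@limit_oo_eq _ _ _ _ 0) => w; rewrite normc_gt0 => w0.
    by rewrite /h invfM invrK mulrACA mulVf ?expf_neq0 // mulr1 exprSr exprMn mulrA.
  rewrite -hE exprM -exprVn.
  set N := (r ^+ n)^-1 ^+ k.+1; have N0 : 0 < N by rewrite exprn_gt0 // invr_gt0.
  have dh w : ~ K w -> derivable h w 1.
    move=> nKw; apply: (@derivable_fun_mul _ (fun w => rho w ^+ k)).
      exact: (derivable_fun_exp (f := rho) (drho _ nKw)).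
    apply: (@derivable_fun_exp _ (fun w => (psi w ^+ n)^-1)).
    apply: (@derivable_fun_inv _ (fun w => psi w ^+ n)); first by rewrite expf_neq0 // psi0.
    exact: (derivable_fun_exp (f := psi) (ext_derivable ext nKw)).
  apply: (@max_modulus R (~` K) h N oK (ltW N0) dh _ z nKz).
  move=> M' NM'; have M'0 : 0 < M' by exact: lt_trans NM'.
  (* The factor [|psi| ^ (- n (k + 1))] is at most [N], so [t ^+ k <= M' / N] ensures [|h| <= M']
     wherever [|rho| < t]. *)
  have [|t t1 tM'] := @exists_expr_le R 1 (M' / N) k.
    by rewrite expr1n ltr_pdivlMr // mul1r.
  have [B hB] := small h M' lh M'0.
  exists [set z | [/\ ~ K z, t <= normc (rho z) & normc z <= B]]; split.
  - exact: prho.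
  - by move=> w [].
  move=> w nKw nS; have [wB|wB] := ltP B (normc w); first exact: hB.
  have wt : normc (rho w) < t.
    by rewrite ltNge; apply/negP => wt; apply: nS.
  move: tM'; rewrite ler_pdivlMr // => /(le_trans _); apply.
  rewrite hE; apply: ler_pM.
  - by rewrite exprn_ge0 // normc_ge0.
  - by rewrite invr_ge0 !exprn_ge0 // normc_ge0.
  - by apply: lerXn2r; rewrite ?nnegrE ?normc_ge0 ?(ltW wt) // ltW // (lt_trans ltr01).
  rewrite /N exprVn lef_pV2 ?posrE ?exprn_gt0 ?psi_gt0 //.
  do 2 (apply: lerXn2r; rewrite ?nnegrE ?exprn_ge0 ?normc_ge0 //).
  exact/ltW/(ext_gt ext).
by move=> z nK; apply/le_anti; rewrite upper // lower.
Qed.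

(** * Conformal maps between subsets of the sphere *)

Lemma complS_someP (R : realType) (K : set R[i]) (z : R[i]) :
  complS K (Some z) <-> ~ K z.
Proof.
split=> [nK Kz|nK [w Kw [wz]]]; first by apply: nK; exists z.
by apply: nK; rewrite -wz.
Qed.

Lemma complS_none (R : realType) (K : set R[i]) : complS K None.
Proof. by move=> [w]. Qed.

(* [0] is a junk value for the point at infinity. *)
Definition finite_part (R : realType) (p : sphere R) : R[i] :=
  if p is Some w then w else 0.

(** If the value at infinity were finite, continuity there would keep [f] bounded outside a compact
    set, whereas [|f z| >= |d| * |z| - C]. *)
Lemma conformal_infinity (R : realType) (f : sphere R -> sphere R) (d : R[i]) (M C : R) :
  {for None, continuous f} -> d != 0 ->
  (forall z, M < normc z -> exists2 w, f (Some z) = Some w & normc (w - d * z) <= C) ->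
  f None = None.
Proof.
move=> cf d0 fC; case E : (f None) => [q|] //; exfalso.
have : nbhs (f None) (Some @` [set w : R[i]^o | normc (w - q) < 1] : set (sphere R)).
  rewrite E; apply: one_point_compactification_some_nbhs.
  by apply/nbhs_normcP; exists 1.
move=> /cf [W [cW _] WV].
have [B B0 hB] := compact_normc_bounded cW.
have nd : 0 < normc d by rewrite normc_gt0.
have [z] := exists_normc_gt (Num.max (Num.max M B) ((`|C| + 1 + normc q) / normc d)).
rewrite !gt_max => /andP[/andP[zM zB]]; rewrite ltr_pdivrMr // => zC.
have [w fz wC] := fC z zM.
have [|v /= vq] := WV (Some z).
  by left; exists z => //= Wz; have := hB z Wz; rewrite leNgt zB.
rewrite fz => -[vw]; rewrite vw in vq.
have := ler_normcB (d * z) (d * z - w).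
rewrite (_ : d * z - (d * z - w) = (w - q) + q); last by ring.
move=> /le_trans/(_ (le_normcD _ _)).
rewrite normcM [normc (d * z - w)]normc_distC.
have := ler_norm C; move: vq wC zC; rewrite [normc z * _]mulrC.
move: (normc (w - q)) (normc (w - d * z)) (normc d * _) (normc q) `|C|.
by move=> x1 x2 x3 x4 x5; lra.
Qed.

(** Infinity is fixed, so by injectivity finite points have finite images, and [finite_part] takes
    no junk value on the domain. Subtracting [b] centres the omitted disc at 0. *)
Lemma conformal_exterior_map (R : realType) (K : set R[i]) (b d : R[i]) (s : R)
    (f : sphere R -> sphere R) (M C : R) : closed (K : set R[i]^o) ->
  conformal (complS K) (complS [set w | normc (w - b) <= s]) f -> d != 0 ->
  (forall z, M < normc z -> ~ K z) ->
  (forall z, M < normc z -> exists2 w, f (Some z) = Some w & normc (w - d * z) <= C) ->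
  [/\ f None = None,
      forall z, ~ K z -> f (Some z) = Some (finite_part (f (Some z))) &
      exterior_map K s d (fun z => finite_part (f (Some z)) - b)].
Proof.
move=> cK [df [fK finj fsurj]] d0 KM fC.
have fN : f None = None.
  by apply: (@conformal_infinity _ f d M C) => //; have [] := df None (@complS_none _ K).
have fS z : ~ K z -> f (Some z) = Some (finite_part (f (Some z))).
  move=> nK; case E : (f (Some z)) => [w|] //.
  have : Some z = None :> sphere R.
    apply: finj; rewrite ?inE ?fN //; [exact/complS_someP|exact: complS_none].
  by [].
split=> //; split=> //.
(* As [f (Some z)] is finite, the chart at this value agrees with [finite_part], including the value
   0 at infinity. *)
- move=> z nK; have [_] := df (Some z) ((complS_someP K z).2 nK).
  rewrite (fS z nK) /= => dz; apply: derivableB; last exact: derivable_cst.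
  exact: dz.
- move=> z nK; have := fK (Some z) ((complS_someP K z).2 nK).
  by rewrite (fS z nK) => /complS_someP /= /negP; rewrite -ltNge.
- move=> z w nKz nKw zw; have : Some z = Some w :> sphere R; last by case.
  apply: finj; rewrite ?inE; [exact/complS_someP|exact/complS_someP|].
  by rewrite (fS z nKz) (fS w nKw); congr Some; apply: (addIr (- b)).
- move=> w sw; have [|p pK fp] := fsurj (Some (w + b)).
    by apply/complS_someP => /=; rewrite addrK; apply/negP; rewrite -ltNge.
  case: p pK fp => [z|] pK fp; last by rewrite fN in fp.
  exists z; first exact/complS_someP.
  by rewrite fp /= addrK.
exists M, (C + normc b) => z zM; split; first exact: KM.
have [w -> wC] := fC z zM; rewrite /= addrAC.
by apply: le_trans (le_normcD _ _) _; rewrite normcN lerD2r.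
Qed.

(** * Laurent series at infinity, sign of the capacity, and polynomial preimages *)

Lemma normc_sum_le (R : realType) (u : nat -> R[i]) (v : nat -> R) n :
  (forall k, normc (u k) <= v k) ->
  normc (\sum_(0 <= k < n) u k) <= \sum_(0 <= k < n) v k.
Proof.
move=> uv; elim: n => [|n IH]; first by rewrite !big_nil normc0.
rewrite !big_nat_recr //=; apply: le_trans (le_normcD _ _) _.
by rewrite lerD.
Qed.

Lemma sum_half_le2 (R : realType) n : \sum_(0 <= k < n) (2 ^- k : R) <= 2.
Proof.
suff -> : \sum_(0 <= k < n) (2 ^- k : R) = 2 - 2 * 2 ^- n.
  by rewrite lerBlDr lerDl mulr_ge0 // invr_ge0 exprn_ge0.
elim: n => [|n IH]; first by rewrite big_nil expr0 invr1 mulr1 subrr.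
by rewrite big_nat_recr //= IH exprS invfM; field; rewrite expf_neq0.
Qed.

(** Convergence at one point [x] gives [|dd k| <= T * x ^ k]. For [|z| > 2 * x] the series is
    dominated by [T] times the geometric series of ratio 1/2, whose sum is 2. *)
Lemma laurent_tail_bounded (R : realType) (g : R[i] -> R[i]) (dd : nat -> R[i]) (M : R) :
  (forall z : R[i], M < normc z ->
    series (fun k => (dd k * z ^- k : R[i]^o)) @ \oo --> (g z : R[i]^o)) ->
  exists M' C : R, M <= M' /\ forall z : R[i], M' < normc z -> normc (g z) <= C.
Proof.
move=> gs.
pose x : R := `|M| + 1; have x0 : 0 < x by rewrite ltr_wpDl.
have Mx : M < x by rewrite (le_lt_trans (ler_norm M)) // ltrDl.
have nx : normc (real_complex R x) = x by rewrite normc_real gtr0_norm.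
have [T T0 hT] : exists2 T : R, 0 < T & forall k, normc (dd k) <= T * x ^+ k.
  have := gs (real_complex R x); rewrite nx => /(_ Mx) cs.
  have c0 : (fun k => (dd k * real_complex R x ^- k : R[i]^o)) @ \oo --> (0 : R[i]^o).
    by apply: cvg_series_cvg_0; apply/cvg_ex; exists (g (real_complex R x)).
  have : nbhs (0 : R[i]^o) [set w : R[i]^o | normc (w - 0) < 1].
    by apply/nbhs_normcP; exists 1.
  move=> /c0 [N _ hN].
  (* The 1 bounds the terms from index [N] on, and the sum bounds each of the earlier ones. *)
  pose T := 1 + \sum_(0 <= k < N) normc (dd k * real_complex R x ^- k).
  have S0 : 0 <= \sum_(0 <= k < N) normc (dd k * real_complex R x ^- k).
    by apply: sumr_ge0 => k _; exact: normc_ge0.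
  exists T => [|k]; first by rewrite ltr_pwDl.
  have dk : normc (dd k * real_complex R x ^- k) = normc (dd k) / x ^+ k.
    by rewrite normcM normcV normcX nx.
  rewrite -ler_pdivrMr ?exprn_gt0 // -dk.
  have [Nk|kN] := leqP N k.
    have := hN k Nk; rewrite /= subr0 => /ltW /le_trans; apply.
    by rewrite lerDl.
  rewrite /T big_mkord (bigD1 (Ordinal kN)) //= addrCA lerDl addr_ge0 //.
  by apply: sumr_ge0 => j _; exact: normc_ge0.
exists (2 * x), (T * 2); split; first by rewrite ltW // (lt_trans Mx) // ltr_pMl // ltr1n.
move=> z zx; have z0 : 0 < normc z by apply: lt_trans zx; rewrite mulr_gt0.
have zM : M < normc z by apply: lt_trans zx; rewrite (lt_trans Mx) // ltr_pMl // ltr1n.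
have term k : normc (dd k * z ^- k) <= T * 2 ^- k.
  rewrite normcM normcV normcX ler_pdivrMr ?exprn_gt0 //.
  apply: le_trans (hT k) _; rewrite -mulrA ler_pM2l // mulrC ler_pdivlMr ?exprn_gt0 //.
  by rewrite -exprMn; apply: lerXn2r; rewrite ?nnegrE ?mulr_ge0 ?(ltW x0) ?(ltW z0) // mulrC ltW.
have sB n : normc (series (fun k => (dd k * z ^- k : R[i]^o)) n) <= T * 2.
  rewrite /series /=; apply: le_trans (normc_sum_le n term) _.
  by rewrite -mulr_sumr ler_pM2l // sum_half_le2.
rewrite -[normc (g z)]subr0 leNgt; apply/negP; rewrite subr0 => big.
have : nbhs (g z : R[i]^o) [set w : R[i]^o | normc (w - g z) < normc (g z) - T * 2].
  by apply/nbhs_normcP; exists (normc (g z) - T * 2) => //; rewrite subr_gt0.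
move=> /(gs z zM) [N _ /(_ N (leqnn N))] /=.
have := ler_normcB (g z) (series (fun k => (dd k * z ^- k : R[i]^o)) N).
rewrite [normc (g z - _)]normc_distC; have := sB N.
by move: (normc _) (normc _) (normc _) => u v w; lra.
Qed.

(** The empty family has supremum minus infinity, which [fine] sends to 0; otherwise some
    exponential lies below the supremum. *)
Lemma cap_ge0 (R : realType) (K : set R[i]) : 0 <= cap K.
Proof.
rewrite /cap; set S := [set _ | _ in _].
have [S0|/set0P[x Sx]] := eqVneq S set0; first by rewrite S0 ereal_sup0.
apply: fine_ge0; apply: le_trans (ereal_sup_ubound Sx).
by case: Sx => mu _ <-; exact: expeR_ge0.
Qed.

Lemma continuous_chorner (R : realType) (P : {poly R[i]}) :
  continuous (fun z : R[i]^o => P.[z] : R[i]^o).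
Proof. by move=> z; apply: derivable_continuous_at; exact: derivable_chorner. Qed.

Lemma preimage_poly_closed (R : realType) (P : {poly R[i]}) (K : set R[i]^o) :
  closed K -> closed ([set z | K P.[z]] : set R[i]^o).
Proof.
move=> cK; apply: (@closed_comp R[i]^o R[i]^o (fun z => P.[z]) K) => // z _.
exact: continuous_chorner.
Qed.

(** [P] is bounded on the disc of radius [B], so this set is the preimage under [P] of a compact set
    from [exterior_map_proper], cut with that disc. *)
Lemma proper_poly_preimage (R : realType) (K : set R[i]^o) r d f (P : {poly R[i]})
    (t B : R) : exterior_map K r d f -> r < t ->
  compact ([set z | [/\ ~ K P.[z], t <= normc (f P.[z]) & normc z <= B]] : set R[i]^o).
Proof.
move=> ext rt.
have cP := @continuous_chorner R P.
pose D : set R[i]^o := [set z | 0 <= normc (z - 0) /\ normc (z - 0) <= B].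
have cD : compact D by exact: compact_annulus.
have [B1 _ hB1] := compact_normc_bounded (continuous_compact (continuous_subspaceT cP) cD).
have cS := exterior_map_proper (B := B1) ext rt.
apply: (@closed_bounded_compact _ _ B); last by move=> z [].
set S := [set z | _] in cS.
rewrite (_ : mkset _ = (fun z : R[i]^o => P.[z] : R[i]^o) @^-1` S `&` D).
  apply: closedI; last exact: compact_closed (@normc_hausdorff R) cD.
  by apply: closed_comp; [move=> z _; exact: cP|exact: compact_closed (@normc_hausdorff R) cS].
apply/seteqP; split => z /=.
  move=> [nK tf zB]; have Dz : D z by rewrite /D /= subr0 normc_ge0.
  by split => //; split => //; apply: hB1; exists z.
by rewrite /D /= subr0 => -[[nK tf _] [_ zB]].
Qed.

Lemma exterior_map_poly (R : realType) (Omega E : set R[i]^o) (r : R) (d : R[i])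
    (psi rm : R[i]^o -> R[i]^o) (P : {poly R[i]}) n :
  (0 < n)%N -> size P = n.+1 -> E = [set z | Omega P.[z]] -> 0 <= r ->
  exterior_map E r 1 psi -> exterior_map Omega 1 d rm ->
  (forall z, ~ E z -> rm P.[z] = d * P`_n * psi z ^+ n) /\
  r ^+ n * normc (d * P`_n) = 1.
Proof.
move=> n0 sz EE r0 ext extR; set c := d * P`_n.
have c0 : c != 0 by rewrite mulf_neq0 ?(poly_lead_neq0 sz) // (ext_lead extR).
have nE z : ~ E z -> ~ Omega P.[z] by rewrite EE.
pose rho (z : R[i]^o) : R[i]^o := rm P.[z].
have drho z : ~ E z -> derivable rho z 1.
  move=> /nE nO; apply: (@derivable_compc _ rm (fun z => P.[z])).
    exact: derivable_chorner.
  exact: ext_derivable extR _ nO.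
have lrho : limit_oo (fun z => rho z / z ^+ n) c := exterior_map_poly_limit extR sz n0.
have main : forall z, ~ E z -> normc (psi z) ^+ n = r ^+ n * normc (rho z).
  apply: (exterior_map_comparison n0 ext r0 drho _ _ c0 lrho).
    by move=> z /nE nO; exact: (ext_gt extR nO).
  by move=> t B t1; rewrite EE; exact: (@proper_poly_preimage _ _ _ _ _ P t B extR t1).
have psi_gt0 z : ~ E z -> 0 < normc (psi z).
  by move=> /(ext_gt ext); exact: le_lt_trans.
have psi0 z : ~ E z -> psi z != 0 by move=> /psi_gt0; rewrite normc_gt0.
have [M [C far]] := ext_bounded ext.
have [z0 /far[nEz0 _]] := exists_normc_gt M.
have rn0 : 0 < r ^+ n.
  rewrite lt_neqAle exprn_ge0 // andbT; apply/eqP => rn.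
  by have := exprn_gt0 n (psi_gt0 _ nEz0); rewrite main // -rn mul0r ltxx.
pose t (z : R[i]^o) : R[i]^o := rho z * (psi z ^+ n)^-1.
have tq z : ~ E z -> normc (t z) = (r ^+ n)^-1.
  move=> nEz; rewrite /t normcM normcV normcX main // invfM mulrCA mulfV ?mulr1 //.
  rewrite gt_eqF // (lt_trans ltr01) //.
  exact: (ext_gt extR (nE z nEz)).
have dt z : ~ E z -> derivable t z 1.
  move=> nEz; apply: (@derivable_fun_mul _ rho); first exact: drho.
  apply: (@derivable_fun_inv _ (fun w => psi w ^+ n)); first by rewrite expf_neq0 // psi0.
  exact: (derivable_fun_exp (f := psi) (ext_derivable ext nEz)).
have lpsi := @exterior_map_limitX _ _ _ _ n ext.
have lt : limit_oo t c.
  have := limit_ooM lrho (limit_ooV (oner_neq0 _) lpsi); rewrite invr1 mulr1.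
  apply: (@limit_oo_eq _ _ _ _ 0) => z; rewrite normc_gt0 => z1.
  by rewrite /t invfM invrK mulrACA mulVf ?expf_neq0 // mulr1.
have tc z (nEz : ~ E z) : t z = c.
  by apply: (exterior_constant_normc ext r0 _ dt tq lt nEz); rewrite invr_gt0.
split=> [z nEz|]; last by rewrite -(tc _ nEz0) tq // mulfV // gt_eqF.
by rewrite -/c -(tc z nEz) /t divfK // expf_neq0 // psi0.
Qed.

(** * The centre, from the coefficients of degree [n - 1] *)

Lemma limit_oo_div_id (R : realType) (f : R[i]^o -> R[i]^o) (b : R[i]) :
  limit_oo (fun z => f z - z) b -> limit_oo (fun z => f z / z) 1.
Proof.
move=> lb; have := limit_ooD (limit_ooM lb (@limit_oo_inv R)) (@limit_oo_cst R 1).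
rewrite mulr0 add0r; apply: (@limit_oo_eq _ _ _ _ 0) => z; rewrite normc_gt0 => z0.
by rewrite mulrBl mulfV // subrK.
Qed.

(** The difference of powers factors as [psi z - z] times a sum of [n + 1] terms, each of which
    tends to 1 after division by [z ^+ n]. *)
Lemma limit_oo_power_difference (R : realType) (psi : R[i]^o -> R[i]^o) (b : R[i]) n :
  limit_oo (fun z => psi z - z) b ->
  limit_oo (fun z => (psi z ^+ n.+1 - z ^+ n.+1) / z ^+ n) (n.+1%:R * b).
Proof.
move=> lb; have l1 := limit_oo_div_id lb.
have ls : limit_oo (fun z => \sum_(j < n.+1) (psi z / z) ^+ (n - j)) n.+1%:R.
  have := @limit_oo_sum R n.+1 (fun j z => (psi z / z) ^+ (n - j)) (fun=> 1).
  rewrite sumr_const card_ord; apply => j.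
  by have := limit_ooX (n := n - j) l1; rewrite expr1n.
have := limit_ooM lb ls; rewrite mulrC; apply: (@limit_oo_eq _ _ _ _ 0) => z.
rewrite normc_gt0 => z0; rewrite subrXX -mulrA; congr (_ * _).
rewrite mulr_suml; apply: eq_bigr => j _.
have jn : (j <= n)%N by rewrite -ltnS.
have -> : z ^+ n = z ^+ (n - j) * z ^+ j by rewrite -exprD subnK.
by rewrite expr_div_n invfM mulrACA mulfV ?mulr1 // expf_neq0.
Qed.

(** The quotient [(rm (P z) - d * p_n * z ^ n) / z ^ (n - 1)] has two limits to be equated:
    [d * p_(n-1)], from the expansion of [P], and [d * p_n * n * b], from the identity with
    [psi ^ n]. *)
Lemma exterior_map_poly_center (R : realType) (Omega : set R[i]^o) (d b : R[i])
    (psi rm : R[i]^o -> R[i]^o) (P : {poly R[i]}) n :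
  (2 <= n)%N -> size P = n.+1 -> exterior_map Omega 1 d rm ->
  limit_oo (fun z => psi z - z) b ->
  (exists M : R, forall z, M < normc z -> rm P.[z] = d * P`_n * psi z ^+ n) ->
  b = P`_n.-1 / (n%:R * P`_n).
Proof.
case: n => [//|[//|n]] _ sz extR lb [M rho] /=.
have p0 := poly_lead_neq0 sz; have d0 := ext_lead extR.
have lE := exterior_map_poly_error (m := n.+1) extR sz (ltn0Sn _) (ltn0Sn _).
pose P' := P - P`_n.+2 *: 'X^(n.+2).
have szP' : (size P' <= n.+2)%N.
  apply/leq_sizeP => j; rewrite leq_eqVlt => /predU1P[<-|nj].
    by rewrite coefB coefZ coefXn eqxx mulr1 subrr.
  rewrite coefB coefZ coefXn gtn_eqF // mulr0 subr0 nth_default //.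
  by rewrite sz.
have lP := limit_oo_poly szP'.
rewrite coefB coefZ coefXn ltn_eqF // mulr0 subr0 in lP.
have l1 := limit_ooD lE (limit_ooM (@limit_oo_cst R d) lP).
have l2 := limit_ooM (@limit_oo_cst R (d * P`_n.+2)) (limit_oo_power_difference (n := n.+1) lb).
have : 0 + d * P`_n.+1 = d * P`_n.+2 * (n.+2%:R * b).
  apply: limit_oo_unique l1 _; apply: (@limit_oo_eq _ _ _ _ M) l2 => z zM.
  rewrite mulrA [d * (_ / _)]mulrA -mulrDl rho // /P' hornerD hornerN hornerZ hornerXn.
  by congr (_ / _); ring.
rewrite add0r -mulrA => /(mulfI d0) ->.
by rewrite mulrA [_ * n.+2%:R]mulrC [_ * b]mulrC mulfK // mulf_neq0 // pnatr_eq0.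
Qed.

Lemma powR_root_inv (R : realType) (r x : R) n : (0 < n)%N -> 0 <= r ->
  r ^+ n * x = 1 -> x `^ (- n%:R^-1) = r.
Proof.
move=> n0 r0 rx.
have rn : r ^+ n != 0 by apply: contraPneq rx => ->; rewrite mul0r => /esym/eqP; rewrite oner_eq0.
have -> : x = (r ^+ n)^-1 by apply: (mulfI rn); rewrite rx mulfV.
rewrite -powR_invn // -powRrM mulrNN mulfV ?powRr1 //.
by rewrite pnatr_eq0 -lt0n.
Qed.

(** * The Walsh map of a connected polynomial preimage *)

Theorem corollary3p7 (R : realType)
  (Omega : set R[i]) (Omega_sc : simply_connected Omega)
  (Omega_infinite : infinite_set Omega) (Omega_compact : compact (Omega : set R[i]^o))
  (Rmap : sphere R -> sphere R) (d1 : R)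
  (Rmap_ext : exterior_riemann_map Omega Rmap d1)
  (n : nat) (n_ge2 : (2 <= n)%N) (P : {poly R[i]}) (degP : size P = n.+1)
  (E : set R[i]) (E_def : E = [set z | Omega P.[z]]) (E_conn : connected (E : set R[i]^o))
  (a : 'I_1 -> R[i]) (m : 'I_1 -> R) (L : set R[i]) (Phi : sphere R -> sphere R)
  (walsh : walsh_data E a m L Phi) :
  let a1 := a ord0 in
  let branch s := root_branch n E Rmap P (real_complex R d1 * P`_n) s /\
                  hydrodynamic (extendS (fun z => a1 + s z)) in
  [/\ L = [set w | normc (w - a1) <= (d1 * normc P`_n) `^ (- n%:R^-1)],
      m ord0 = 1,
      a1 = - (P`_n.-1 / (n%:R * P`_n)),
      (exists s, branch s) &
      forall s, branch s ->
        forall p, complS E p -> Phi p = extendS (fun z => a1 + s z) p].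
Proof.
move=> a1 branch; case: walsh => ainj [m0 msum] LE Pconf [M [c Phyd]].
have m1 : m ord0 = 1 by rewrite -msum big_ord1.
set r := cap E in LE; have r0 : 0 <= r by exact: cap_ge0.
have LE' : L = [set w | normc (w - a1) <= r].
  rewrite LE; apply/seteqP; split => w /=;
  by rewrite big_ord1 m1 powRr1 // normc_ge0.
have n0 : (0 < n)%N by exact: ltn_trans n_ge2.
have p0 := poly_lead_neq0 degP.
have cO : closed (Omega : set R[i]^o).
  by apply: compact_closed Omega_compact; exact: normc_hausdorff.
have cE : closed (E : set R[i]^o) by rewrite E_def; exact: preimage_poly_closed.
have [B1 _ hB1] := compact_normc_bounded Omega_compact.
have [B2 hB2] := poly_large degP n0 B1.
have farE z : B2 < normc z -> ~ E z.
  by rewrite E_def => /hB2 /= Pz /hB1; rewrite leNgt Pz.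
have nE z : ~ E z -> ~ Omega P.[z] by rewrite E_def.
(* The threshold 1 weakens the bound [c / |z|] to the constant [|c|]. *)
have far1 z : Num.max 1 (Num.max M B2) < normc z -> [/\ 1 < normc z, M < normc z & B2 < normc z].
  by rewrite !gt_max => /andP[? /andP[? ?]].
have [||||PhiN PhiS extP] := @conformal_exterior_map R E a1 1 r Phi
    (Num.max 1 (Num.max M B2)) `|c| cE.
- by rewrite -LE'.
- exact: oner_neq0.
- by move=> z /far1[_ _ /farE].
- move=> z /far1[z1 /Phyd[w Pw wc] _]; exists w => //; rewrite mul1r.
  have z_gt0 : 0 < normc z by exact: lt_trans z1.
  apply: le_trans wc _; rewrite ler_pdivrMr // (le_trans (ler_norm _)) //.
  by rewrite ler_peMr // ltW.
have [Rconf d1_gt0 [M1 [dd Rser]]] := Rmap_ext.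
have Rlim z : M1 < normc z ->
    series (fun k => (dd k * z ^- k : R[i]^o)) @ \oo -->
      (finite_part (Rmap (Some z)) - real_complex R d1 * z : R[i]^o).
  by move=> /Rser[w -> h].
have [M2 [C2 [M12 hC2]]] := laurent_tail_bounded Rlim.
have [||||RN RS extR] := @conformal_exterior_map R Omega 0 (real_complex R d1) 1 Rmap
    (Num.max M2 B1) C2 cO.
- rewrite (_ : [set w | _] = [set w : R[i] | normc w <= 1]) //.
  by apply/seteqP; split => w /=; rewrite subr0.
- by rewrite -normc_eq0 normc_real normr_eq0 gt_eqF.
- by move=> z; rewrite gt_max => /andP[_ zB] /hB1; rewrite leNgt zB.
- move=> z; rewrite gt_max => /andP[zM _].
  have [w Rw _] := Rser z (le_lt_trans M12 zM); exists w => //.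
  by have := hC2 z zM; rewrite Rw.
set psi := (fun z => finite_part (Phi (Some z)) - a1) in extP.
set rm := (fun z => finite_part (Rmap (Some z)) - 0) in extR.
have [rhoE rn] := exterior_map_poly n0 degP E_def r0 extP extR.
have psi0 z : ~ E z -> psi z != 0.
  by move=> nEz; rewrite -normc_gt0; exact: le_lt_trans (ext_gt extP nEz).
have PhiE z : ~ E z -> Phi (Some z) = Some (a1 + psi z).
  by move=> nEz; rewrite /psi addrC subrK; exact: PhiS.
have RE z : ~ E z -> Rmap (Some P.[z]) = Some (rm P.[z]).
  by move=> nEz; rewrite /rm subr0; exact: RS (nE z nEz).
have hyd_limit (s : R[i]^o -> R[i]^o) : hydrodynamic (extendS (fun z => a1 + s z)) ->
    limit_oo (fun z => s z - z) (- a1).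
  move=> [N [k hk]]; apply/limit_ooP => e e0.
  exists (Num.max N ((`|k| + 1) / e)) => z; rewrite gt_max => /andP[/hk[w [<-] wk]].
  rewrite ltr_pdivrMr // => ze; rewrite (_ : s z - z - - a1 = a1 + s z - z); last by ring.
  have z_gt0 : 0 < normc z.
    by rewrite -(pmulr_lgt0 _ e0); apply: le_lt_trans ze; rewrite addr_ge0.
  apply: le_lt_trans wk _; rewrite ltr_pdivrMr // mulrC.
  by rewrite (le_lt_trans (ler_norm k)) // (lt_trans _ ze) // ltrDl.
have psi_hyd : hydrodynamic (extendS (fun z => a1 + psi z)).
  exists (Num.max M B2), c => z; rewrite gt_max => /andP[zM /farE nEz].
  have [w Pw wc] := Phyd z zM; exists w => //=.
  by rewrite -Pw PhiE.
(* No root is extracted: [psi] is already holomorphic and its [n]-th power is known. *)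
have psi_branch : root_branch n E Rmap P (real_complex R d1 * P`_n) psi.
  split=> [z nEz|z nEz]; first exact: (ext_derivable extP nEz).
  exists (rm P.[z]); first exact: RE.
  rewrite rhoE // mulrAC mulfV ?mul1r // mulf_neq0 //; exact: (ext_lead extR).
split=> //.
- rewrite LE' (_ : _ `^ _ = r) //; apply: (powR_root_inv n0 r0).
  by rewrite -rn normcM normc_real gtr0_norm.
(* The sign arises because [psi z - z] tends to [- a1], as [a1 + psi z = z + O(1/z)]. *)
- apply: oppr_inj; rewrite opprK.
  apply: (exterior_map_poly_center n_ge2 degP extR (hyd_limit _ psi_hyd)).
  by exists B2 => z /farE; exact: rhoE.
- by exists psi.
(* At infinity both maps take the value [None], so only [s = psi] at finite points remains. *)
move=> s [[ds sE] shyd] [z /complS_someP nEz|_] /=; last exact: PhiN.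
suff -> : s z = psi z by exact: PhiE.
pose t (w : R[i]^o) : R[i]^o := s w * (psi w)^-1.
suff : t z = 1 by rewrite /t => /(canRL (mulfVK (psi0 z nEz))); rewrite mul1r.
apply: (exterior_constant_normc extP r0 ltr01 _ _ _ nEz).
- move=> w nEw; apply: (@derivable_fun_mul _ s); first exact: ds.
  exact: (derivable_fun_inv (f := psi) (psi0 w nEw) (ext_derivable extP nEw)).
- move=> w nEw; rewrite /t normcM normcV.
  have [x Rx sx] := sE w nEw; have [y Ry py] := psi_branch.2 w nEw.
  have xy : x = y by move: Rx; rewrite Ry => -[].
  have : normc (s w) ^+ n = normc (psi w) ^+ n by rewrite -!normcX sx py xy.
  move/eqP; rewrite eqrXn2 ?normc_ge0 // => /eqP ->.
  by rewrite mulfV // gt_eqF // normc_gt0 psi0.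
have := limit_ooM (limit_oo_div_id (hyd_limit _ shyd))
  (limit_ooV (oner_neq0 _) (limit_oo_div_id (hyd_limit _ psi_hyd))).
rewrite invr1 mulr1; apply: (@limit_oo_eq _ _ _ _ 0) => w; rewrite normc_gt0 => w0.
by rewrite /t invfM invrK mulrACA mulVf // mulr1.
Qed.
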